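(* Let $1<p<q$ be relatively prime integers and $d:=\frac12(p-1)(q-1)$. For any integer $l$ with $1\le l\le d$ there is a nodal curve of type $p,q$ over $K$ with exactly $l$ nodes.
   Context: $K$ is an algebraically closed field of characteristic $0$; $\mathbb N=\{0,1,2,\dots\}$. A curve of type $p,q$ is the zero set $C\subset\mathbb A^2(K)$ of a normed Weierstraß polynomial of type $p,q$, i.e. of a polynomial $$F(X,Y)=Y^p-X^q+\sum_{\nu p+\mu q<pq}a_{\nu\mu}X^\nu Y^\mu,\qquad a_{\nu\mu}\in K,\ (\nu,\mu)\in\mathbb N^2.$$ Singularities of $C$ are the points where $F$, $F_X$ and $F_Y$ vanish. A node is a singularity at which the Hesse determinant $F_{XX}F_{YY}-F_{XY}^2$ does not vanish (an ordinary double point). A nodal curve is one all of whose singularities are nodes. *)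

(* Defs.v *)
From HB Require Import structures.
From mathcomp Require Import all_boot all_order all_algebra.

Set Implicit Arguments.
Unset Strict Implicit.
Unset Printing Implicit Defensive.

Import GRing.Theory.
Local Open Scope ring_scope.

(* Polynomials in X, Y are elements of {poly {poly K}} with the conventions of
   polyXY: the outer variable 'X is X, the inner one 'Y is Y. *)

(* The bounds nu < q and mu < p are implied by nu * p + mu * q < p * q; they
   only serve to make the sum syntactically finite. *)
Definition normed_weierstrass (K : fieldType) (p q : nat)
    (F : {poly {poly K}}) : Prop :=
  exists a : nat -> nat -> K,
    F = 'Y ^+ p - 'X ^+ q
        + \sum_(nu < q) \sum_(mu < p | (nu * p + mu * q < p * q)%N)
            (a nu mu)%:P%:P * 'X ^+ nu * 'Y ^+ mu.

Definition dX (K : fieldType) (F : {poly {poly K}}) : {poly {poly K}} :=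
  F^`().

Definition dY (K : fieldType) (F : {poly {poly K}}) : {poly {poly K}} :=
  map_poly (@deriv K) F.

Definition hesse_det (K : fieldType) (F : {poly {poly K}}) : {poly {poly K}} :=
  dX (dX F) * dY (dY F) - dY (dX F) ^+ 2.

Definition curve (K : fieldType) (F : {poly {poly K}}) : {pred K * K} :=
  [pred P | F.[P.1, P.2] == 0].

Definition singularity (K : fieldType) (F : {poly {poly K}}) : {pred K * K} :=
  [pred P in curve F | ((dX F).[P.1, P.2] == 0) && ((dY F).[P.1, P.2] == 0)].

Definition node (K : fieldType) (F : {poly {poly K}}) : {pred K * K} :=
  [pred P in singularity F | (hesse_det F).[P.1, P.2] != 0].

(* A curve is handled through its polynomial F, on which singularities and
   nodes depend. *)
Definition nodal (K : fieldType) (F : {poly {poly K}}) : Prop :=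
  {subset singularity F <= node F}.

Definition has_exactly_nodes (K : fieldType) (F : {poly {poly K}})
    (l : nat) : Prop :=
  exists s : seq (K * K), [/\ uniq s, size s = l & s =i node F].

(* Main.v *)
Require Import Defs.
From Stdlib Require Import Classical.
From mathcomp Require Import all_boot all_order all_algebra.
From mathcomp Require Import separable cyclic cyclotomic.
From mathcomp Require Import ring zify.

(** Let D_n be the Chebyshev polynomial normalised by D_n(z + 1/z) = z^n + 1/z^n.
    The curve D_p(Y) - D_q(X) = 0 is of type p, q.  Its critical points form a grid
    of (p - 1)(q - 1) = 2d points, all of them nondegenerate, at which the critical
    values D_p(y) - D_q(x) are 0, 4 or -4, and d of them are on the curve: this is
    the case l = d.  The other cases are obtained by deforming this curve so that l
    of the nodes persist and d - l of them disappear.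

    Nodes can be smoothed independently: to first order the critical value at a
    node only varies with the equation of the curve, and the values at the d nodes
    of the monomials X^i Y^k with i p + k q <= pq - p - q are linearly independent
    ([adjoint_vanish]).  Indeed the curve has the parametrisation
    t |-> (D_p(t), D_q(t)); an adjoint polynomial vanishing at the nodes pulls back
    to a polynomial in t of degree less than 2d with 2d roots, two for each node.
    There are d such monomials, so they take arbitrary values at the nodes.

    Newton iteration therefore produces, over the power series in one variable s, a
    deformation of the curve and of its 2d critical points along which l nodes keep
    the critical value 0 and the others get the critical value s
    ([newton_arc_solves]).

    To return to the field K, regard this deformation as a point over the domain
    K[[s]] of an affine space over K whose coordinates are the coefficients of the
    curve and the coordinates of its 2d critical points.  The polynomials that vanish
    there form a prime ideal ([arc_ideal_prime]).  By the Nullstellensatz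
    ([has_points_poly]) this ideal has a zero over K at which finitely many given
    polynomials outside the ideal do not vanish.  So all equations satisfied by the
    formal deformation are satisfied by a curve over K, and the marked critical
    points can be kept distinct, nondegenerate, and off the curve except for the l
    chosen ones ([specialize_deformation]).

    Finally a curve of type p, q has at most 2d critical points
    ([critical_points_card]), so the marked ones are all of them, and the
    singularities are the l chosen nodes. *)

Set Implicit Arguments.
Unset Strict Implicit.
Unset Printing Implicit Defensive.

Import GRing.Theory.
Local Open Scope ring_scope.

(** * The Nullstellensatz for prime ideals *)

Record prime_ideal (R : comNzRingType) (P : R -> Prop) : Prop := PrimeIdeal {
  prime_ideal0 : P 0;
  prime_idealD : forall a b, P a -> P b -> P (a + b);
  prime_idealMl : forall a b, P b -> P (a * b);
  prime_ideal_proper : ~ P 1;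
  prime_idealM : forall a b, P (a * b) -> P a \/ P b }.

Section PrimeIdealTheory.

Variables (R : comNzRingType) (P : R -> Prop).
Hypothesis primeP : prime_ideal P.

Lemma prime_idealMr a b : P a -> P (a * b).
Proof. by rewrite mulrC; apply: (prime_idealMl primeP). Qed.

Lemma prime_idealB a b : P a -> P b -> P (a - b).
Proof.
move=> Pa Pb; apply: (prime_idealD primeP) => //.
by rewrite -mulN1r; apply: (prime_idealMl primeP).
Qed.

Lemma prime_ideal_sum (I : Type) (r : seq I) (Q : pred I) (E : I -> R) :
  (forall i, Q i -> P (E i)) -> P (\sum_(i <- r | Q i) E i).
Proof.
move=> PE; elim/big_ind: _ => //; first exact: (prime_ideal0 primeP).
exact: (prime_idealD primeP).
Qed.

Lemma prime_idealX a n : P (a ^+ n) -> P a.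
Proof.
elim: n => [|n IHn]; first by rewrite expr0 => /(prime_ideal_proper primeP).
by rewrite exprS => /(prime_idealM primeP)[].
Qed.

Lemma prime_ideal_prod (I : Type) (r : seq I) (Q : pred I) (E : I -> R) :
  (forall i, Q i -> ~ P (E i)) -> ~ P (\prod_(i <- r | Q i) E i).
Proof.
move=> nPE; elim/big_ind: _ => //; first exact: (prime_ideal_proper primeP).
by move=> a b nPa nPb /(prime_idealM primeP)[].
Qed.

End PrimeIdealTheory.

Lemma prime_ideal_comp (R S : comNzRingType) (f : {rmorphism R -> S})
    (P : S -> Prop) : prime_ideal P -> prime_ideal (fun a => P (f a)).
Proof.
case=> P0 PD PM P1 PP; split=> [|a b|a b||a b].
- by rewrite rmorph0.
- by rewrite rmorphD; apply: PD.
- by rewrite rmorphM; apply: PM.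
- by rewrite rmorph1.
- by rewrite rmorphM; apply: PP.
Qed.

(** The Nullstellensatz for the prime ideals of the K-algebra B, whose K-points
    are the ring morphisms [psi] to K over K.  The nonvanishing condition
    [psi u != 0] is part of the statement because the passage from B to {poly B}
    uses it: it keeps leading coefficients from vanishing at the chosen point. *)
Definition has_points (K : closedFieldType) (B : comNzRingType)
    (iota : K -> B) : Prop :=
  forall (P : B -> Prop) (u : B), prime_ideal P -> ~ P u ->
  exists psi : {rmorphism B -> K},
    [/\ forall c, psi (iota c) = c, forall h, P h -> psi h = 0 & psi u != 0].

Lemma has_points_field (K : closedFieldType) : has_points (@id K).
Proof.
move=> P u primeP nPu; exists (idfun : {rmorphism K -> K}); split=> //= [h Ph|].
  apply/eqP; apply: contra_notT (prime_ideal_proper primeP) => h0.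
  by rewrite -(mulVf h0); apply: (prime_idealMl primeP).
by apply: contra_not_neq nPu => ->; apply: (prime_ideal0 primeP).
Qed.

Section PolynomialExtension.

Variables (K : closedFieldType) (B : idomainType) (iota : K -> B).
Hypothesis pointsB : has_points iota.

Section PrimeIdealOfPolynomials.

Variable P : {poly B} -> Prop.
Hypothesis primeP : prime_ideal P.

Let PC (b : B) : Prop := P b%:P.

Let primePC : prime_ideal PC.
Proof.
exact: (prime_ideal_comp (polyC : {rmorphism B -> {poly B}}) primeP).
Qed.

(** The kernel of the reduction of coefficients, from {poly B} to (B / PC)[X]. *)
Let coefs_in (g : {poly B}) : Prop := forall i, PC g`_i.

Let coefs_inP g : coefs_in g -> P g.
Proof.
move=> Pg; rewrite -[g]coefK poly_def; apply: (prime_ideal_sum primeP) => i _.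
by rewrite -mul_polyC; apply: (prime_idealMr primeP); apply: Pg.
Qed.

Let coefs_inD g h : coefs_in g -> coefs_in h -> coefs_in (g + h).
Proof. by move=> Pg Ph i; rewrite coefD; apply: (prime_idealD primePC). Qed.

Let coefs_inMr g h : coefs_in g -> coefs_in (g * h).
Proof.
move=> Pg i; rewrite coefM; apply: (prime_ideal_sum primePC) => j _.
exact: (prime_idealMr primePC).
Qed.

Let drop_lead (g : {poly B}) := g - lead_coef g *: 'X ^+ (size g).-1.

Let size_drop_lead g : g != 0 -> (size (drop_lead g) < size g)%N.
Proof.
move=> g0; rewrite [X in (_ < X)%N](polySpred g0) ltnS; apply/leq_sizeP => j le_j.
rewrite coefB coefZ coefXn; have [->|neq_j] := eqVneq j (size g).-1.
  by rewrite mulr1 lead_coefE subrr.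
rewrite mulr0 subr0 nth_default // (polySpred g0) ltn_neqAle eq_sym neq_j.
exact: le_j.
Qed.

Let drop_leadK g : g = drop_lead g + (lead_coef g)%:P * 'X ^+ (size g).-1.
Proof. by rewrite mul_polyC subrK. Qed.

Let P_drop_lead g : PC (lead_coef g) -> P g <-> P (drop_lead g).
Proof.
move=> Plc; have Pt : P ((lead_coef g)%:P * 'X ^+ (size g).-1).
  exact: (prime_idealMr primeP).
split=> Pg; last by rewrite (drop_leadK g); apply: (prime_idealD primeP).
by rewrite /drop_lead -mul_polyC; apply: (prime_idealB primeP).
Qed.

Let coefs_in_ind n :
  (forall g, P g -> (size g < n)%N -> PC (lead_coef g)) ->
  forall g, P g -> (size g < n)%N -> coefs_in g.
Proof.
move=> Plc g; have [m] := ubnP (size g); elim: m g => // m IHm g lt_m Pg lt_n.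
have [->|g0] := eqVneq g 0.
  by move=> i; rewrite coef0; apply: (prime_ideal0 primePC).
have lt_g := size_drop_lead g0; have Pl := Plc g Pg lt_n.
rewrite (drop_leadK g); apply: coefs_inD; last first.
  apply: coefs_inMr => i; rewrite coefC; case: ifP => // _.
  exact: (prime_ideal0 primePC).
apply: IHm; first by apply: leq_trans lt_g _.
  exact/(P_drop_lead Pl).
exact: ltn_trans lt_g lt_n.
Qed.

(** When the class of 'X is transcendental over B / PC, the ideal P is generated
    by PC: over a point of the base the zero set of P is the whole affine line,
    and u is a nonzero polynomial on it as soon as one of its coefficients is
    nonzero at the base point. *)
Lemma points_transcendental u :
  (forall g, P g -> PC (lead_coef g)) -> ~ P u ->
  exists psi : {rmorphism {poly B} -> K},
    [/\ forall c, psi (iota c)%:P = c, forall h, P h -> psi h = 0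
      & psi u != 0].
Proof.
move=> Plc nPu.
have Pcoefs g : P g -> coefs_in g.
  by move=> Pg; apply: (@coefs_in_ind (size g).+1) => // h Ph _; apply: Plc.
have [i nPi] : exists i, ~ PC u`_i.
  apply: not_all_ex_not => Pu; exact/nPu/coefs_inP.
have [psi [psiK psiP psiu]] := pointsB primePC nPi.
have u0 : map_poly psi u != 0.
  by apply: contra_neq psiu => /(congr1 (coefp i)); rewrite /= coef_map coef0.
have /closed_nonrootP[z nz] := u0.
have comm : commr_rmorph psi z by move=> a; apply: mulrC.
exists (horner_morph comm : {rmorphism {poly B} -> K}); split=> [c|h Ph|] //=.
  by rewrite horner_morphC.
rewrite /horner_morph; suff -> : map_poly psi h = 0 by rewrite horner0.
by apply/polyP => j; rewrite coef_map coef0; apply/psiP/Pcoefs.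
Qed.

Section Algebraic.

(* Up to a denominator, f is the minimal polynomial of the class of 'X over the
   field of fractions of B / PC. *)
Variable f : {poly B}.
Hypotheses (Pf : P f) (nPf : ~ PC (lead_coef f)).
Hypothesis f_min : forall g, P g -> (size g < size f)%N -> PC (lead_coef g).

Let f_neq0 : f != 0.
Proof.
apply: contra_not_neq nPf => ->; rewrite lead_coef0.
exact: (prime_ideal0 primePC).
Qed.

Let size_f : (1 < size f)%N.
Proof.
rewrite ltnNge; apply/negP => /size1_polyC fC; apply: nPf.
by move: Pf; rewrite fC lead_coefC.
Qed.

Let small_coefs g : P g -> (size g < size f)%N -> coefs_in g.
Proof. exact: coefs_in_ind. Qed.

Let pdivE (g h : {poly B}) :
  (lead_coef h ^+ scalp g h)%:P * g = g %/ h * h + g %% h.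
Proof. by rewrite mul_polyC Pdiv.Idomain.divp_eq. Qed.

Let PX g h n : ~ PC (lead_coef h) -> P ((lead_coef h ^+ n)%:P * g) -> P g.
Proof.
move=> nPh /(prime_idealM primeP)[] // /(prime_idealX primePC)//.
Qed.

(** The class of u is a nonzero element of an algebraic extension of the field
    of fractions of B / PC, hence invertible: up to a denominator N it has an
    inverse b.  The inverse is found by Euclidean descent on the size of u, the
    minimality of f keeping the remainders outside P. *)
Lemma algebraic_elimination u : ~ P u ->
  exists (N : B) (b : {poly B}), ~ PC N /\ P (N%:P - b * u).
Proof.
have [m] := ubnP (size u); elim: m u => // m IHm u lt_m nPu.
have u0 : u != 0.
  by apply: contra_not_neq nPu => ->; apply: (prime_ideal0 primeP).
have step (r c q : {poly B}) :
    (size r < size u)%N -> ~ P r -> P (r - c * u - q) -> P q ->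
    exists (N : B) (b : {poly B}), ~ PC N /\ P (N%:P - b * u).
  move=> lt_r nPr Pr Pq.
  have [|N [b [nPN Pb]]] := IHm r _ nPr; first exact: leq_trans lt_r _.
  exists N, (b * c); split=> //.
  have -> : N%:P - b * c * u = (N%:P - b * r) + b * (r - c * u - q) + b * q.
    by rewrite !mulrBr mulrA; ring.
  by apply: (prime_idealD primeP); first apply: (prime_idealD primeP) => //;
    apply: (prime_idealMl primeP).
have [Plu|nPlu] := classic (PC (lead_coef u)).
  apply: (step (drop_lead u) 1 (- ((lead_coef u)%:P * 'X ^+ (size u).-1))).
  - exact: size_drop_lead.
  - by move=> /(P_drop_lead Plu).
  - rewrite mul1r {2}(drop_leadK u) opprK.
    suff -> : forall a b : {poly B}, a - (a + b) + b = 0.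
      exact: (prime_ideal0 primeP).
    by move=> a b; ring.
  - rewrite -mulrN; apply: (prime_idealMr primeP); exact: Plu.
have [le1|gt1] := leqP (size u) 1.
  move: nPu; rewrite (size1_polyC le1) => nPu; exists u`_0, 1; split=> //.
  by rewrite mul1r subrr; apply: (prime_ideal0 primeP).
have [le_fu|lt_uf] := leqP (size f) (size u).
  apply: (step (u %% f) (lead_coef f ^+ scalp u f)%:P (- (u %/ f * f))).
  - by apply: leq_trans le_fu; rewrite ltn_modp.
  - move=> Pr; apply: nPu; apply: (PX (n := scalp u f) nPf).
    rewrite pdivE; apply: (prime_idealD primeP) => //.
    exact: (prime_idealMl primeP).
  - rewrite pdivE; suff -> : forall a b : {poly B}, b - (a + b) - - a = 0.
      exact: (prime_ideal0 primeP).
    by move=> a b; ring.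
  - by rewrite -mulNr; apply: (prime_idealMl primeP).
apply: (step (f %% u) (- (f %/ u)) ((lead_coef u ^+ scalp f u)%:P * f)).
- by rewrite ltn_modp.
- move=> Pr.
  have lt_ru : (size (f %% u)%R < size u)%N by rewrite ltn_modp.
  (* If the remainder were in P then so would be the quotient; both being smaller
     than f, they vanish over B / PC, and so does a multiple of f by a
     nonzero constant. *)
  have Cr := small_coefs Pr (ltn_trans lt_ru lt_uf).
  have Pq : P (f %/ u).
    have : P (f %/ u * u).
      have -> : f %/ u * u = (lead_coef u ^+ scalp f u)%:P * f - f %% u.
        by rewrite pdivE addrK.
      by apply: (prime_idealB primeP) => //; apply: (prime_idealMl primeP).
    by case/(prime_idealM primeP).
  have lt_q : (size (f %/ u)%R < size f)%N.
    rewrite Pdiv.Idomain.size_divp // -subn1 ltn_subrL subn_gt0 gt1.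
    exact: ltn_trans size_f.
  have Cq := small_coefs Pq lt_q.
  have := coefs_inD (coefs_inMr u Cq) Cr; rewrite -pdivE.
  move=> /(_ (size f).-1); rewrite coefCM -lead_coefE.
  by case/(prime_idealM primePC) => // /(prime_idealX primePC).
- rewrite pdivE; suff -> : forall a b : {poly B}, b - - a * u - (a * u + b) = 0.
    exact: (prime_ideal0 primeP).
  by move=> a b; ring.
- exact: (prime_idealMl primeP).
Qed.

(** Take a base point at which the leading coefficient of f and the constant N
    of the elimination lemma do not vanish, and extend it by a root z of f.
    Dividing any h in P by f leaves a remainder that vanishes over B / PC, so h
    vanishes at z; and u does not, because it divides N there. *)
Lemma points_algebraic u : ~ P u ->
  exists psi : {rmorphism {poly B} -> K},
    [/\ forall c, psi (iota c)%:P = c, forall h, P h -> psi h = 0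
      & psi u != 0].
Proof.
move=> /algebraic_elimination[N [b [nPN Pb]]].
have nPfN : ~ PC (lead_coef f * N) by move=> /(prime_idealM primePC)[].
have [psi [psiK psiP psifN]] := pointsB primePC nPfN.
have /andP[psif psiN] : (psi (lead_coef f) != 0) && (psi N != 0).
  by rewrite -negb_or -mulf_eq0 -rmorphM.
have /closed_rootP[z /eqP fz] : size (map_poly psi f) != 1.
  by rewrite size_map_poly_id0 // neq_ltn size_f orbT.
have comm : commr_rmorph psi z by move=> a; apply: mulrC.
pose psi' : {rmorphism {poly B} -> K} := horner_morph comm.
have psi'C c : psi' c%:P = psi c by apply: horner_morphC.
have psi'f : psi' f = 0 by [].
have psi'P h : P h -> psi' h = 0.
  move=> Ph; apply/eqP; move/(congr1 psi'): (pdivE h f) => /eqP.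
  have Pr : P (h %% f).
    have -> : h %% f = (lead_coef f ^+ scalp h f)%:P * h - h %/ f * f.
      by rewrite pdivE addrC addKr.
    by apply: (prime_idealB primeP); apply: (prime_idealMl primeP).
  have -> : psi' (h %/ f * f + h %% f) = 0.
    rewrite rmorphD rmorphM psi'f mulr0 add0r /psi' /= /horner_morph.
    suff -> : map_poly psi (h %% f) = 0 by rewrite horner0.
    apply/polyP => j; rewrite coef_map coef0; apply/psiP/small_coefs => //.
    by rewrite ltn_modp.
  rewrite rmorphM psi'C rmorphXn mulf_eq0 expf_eq0 (negPf psif) andbF.
  by [].
exists psi'; split=> // [c|]; first by rewrite psi'C psiK.
apply: contra_neq psiN => u0; have /eqP := psi'P _ Pb.
by rewrite rmorphB rmorphM u0 mulr0 subr0 psi'C => /eqP.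
Qed.

End Algebraic.

End PrimeIdealOfPolynomials.

Lemma has_points_poly : has_points (fun c => (iota c)%:P).
Proof.
move=> P u primeP nPu.
have [all_lc|] := classic (forall g, P g -> P (lead_coef g)%:P).
  exact: points_transcendental.
move=> /not_all_ex_not[g nPg]; have {nPg}[Pg nPg] := imply_to_and _ _ nPg.
(* Make g minimal among the elements of P that have such a leading coefficient. *)
have [m] := ubnP (size g); elim: m g Pg nPg => // m IHm g Pg nPg lt_m.
have [g_min|] :=
  classic (forall h, P h -> (size h < size g)%N -> P (lead_coef h)%:P).
  exact: (points_algebraic primeP Pg nPg g_min nPu).
move=> /not_all_ex_not[h nPh]; have {nPh}[Ph nPh] := imply_to_and _ _ nPh.
have {nPh}[lt_h nPh] := imply_to_and _ _ nPh.
by apply: (IHm h) => //; apply: leq_trans lt_h _.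
Qed.

End PolynomialExtension.

(** Polynomial rings in variables indexed by V, by their universal property
    [pr_eval] and the fact [pr_ind] that the variables generate; they are built
    by iterating {poly _}, to which [has_points_poly] applies. *)
Record polynomial_ring (K : closedFieldType) (V : finType) := PolynomialRing {
  pr_sort : idomainType;
  pr_const : {rmorphism K -> pr_sort};
  pr_var : V -> pr_sort;
  pr_points : has_points pr_const;
  pr_eval : forall (S : comNzRingType) (kappa : {rmorphism K -> S})
      (z : V -> S),
    {rho : {rmorphism pr_sort -> S} |
      rho \o pr_const =1 kappa & rho \o pr_var =1 z};
  pr_ind : forall Q : pr_sort -> Prop,
    (forall c, Q (pr_const c)) -> (forall v, Q (pr_var v)) ->
    (forall a b, Q a -> Q b -> Q (a + b)) ->
    (forall a b, Q a -> Q b -> Q (a * b)) -> forall a, Q a }.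

Lemma polynomial_ring_ord (K : closedFieldType) n : polynomial_ring K 'I_n.
Proof.
elim: n => [|n [R iota x pts ev ind]].
  apply: (@PolynomialRing K 'I_0 K (idfun : {rmorphism K -> K}) (fun=> 0)).
  - exact: has_points_field.
  - by move=> S kappa z; exists kappa => // -[].
  - by move=> Q QC _ _ _; apply: QC.
pose y (i : 'I_n.+1) := if unlift ord_max i is Some j then (x j)%:P else 'X.
pose iota' : {rmorphism K -> {poly R}} := (polyC : {rmorphism R -> _}) \o iota.
apply: (@PolynomialRing K 'I_n.+1 {poly R} iota' y) => [|S kappa z|Q QC Qv QD QM].
- exact: has_points_poly.
- have [rho rhoC rhoX] := ev S kappa (z \o lift ord_max).
  have comm : commr_rmorph rho (z ord_max) by move=> a; apply: mulrC.
  exists (horner_morph comm : {rmorphism {poly R} -> S}) => [c|i] /=.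
    by rewrite horner_morphC -rhoC.
  rewrite /y; case: unliftP => [j|] ->.
    by rewrite horner_morphC; apply: rhoX.
  exact: horner_morphX.
- have QP a : Q a%:P.
    apply: (ind (fun a => Q a%:P)) => [|j|b c|b c] //.
    - by have := Qv (lift ord_max j); rewrite /y liftK.
    - by rewrite rmorphD; apply: QD.
    - by rewrite rmorphM; apply: QM.
  have QX : Q 'X by have := Qv ord_max; rewrite /y unlift_none.
  by elim/poly_ind => [|p c Qp]; [apply: QP | apply: QD => //; apply: QM].
Qed.

Lemma polynomial_ring_fin (K : closedFieldType) (V : finType) :
  polynomial_ring K V.
Proof.
have [R iota x pts ev ind] := polynomial_ring_ord K #|V|.
apply: (@PolynomialRing K V R iota (x \o enum_rank)) => // [S kappa z|Q QC Qv].
  have [rho rhoC rhoX] := ev S kappa (z \o enum_val).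
  by exists rho => // v; rewrite [LHS]rhoX /= enum_rankK.
by apply: ind => // i; have := Qv (enum_val i); rewrite /= enum_valK.
Qed.

(** * Prime ideals of formal arcs *)

Definition vanishes_to (K : nzRingType) (M : nat) (h : {poly K}) : Prop :=
  forall i, (i < M)%N -> h`_i = 0.

Lemma vanishes_toP (K : fieldType) M (h : {poly K}) :
  reflect (vanishes_to M h) ('X^M %| h).
Proof.
apply: (iffP idP) => [/dvdpP[g ->] i lt_i|h0]; first by rewrite coefMXn lt_i.
have -> : h = drop_poly M h * 'X^M; last exact: dvdp_mull.
apply/polyP => i; rewrite coefMXn coef_drop_poly; case: ltnP => [/h0 //|le].
by rewrite subnK.
Qed.

(** The compatible truncated arcs [z M], for M = 0, 1, ..., define a point of affine
    space over the domain K[[s]], the variable s being 'X here; the ideal below is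
    the kernel of the evaluation at this point. *)
Lemma arc_ideal_prime (K : closedFieldType) (V : finType)
    (R : polynomial_ring K V) (z : nat -> V -> {poly K})
    (rho : nat -> {rmorphism pr_sort R -> {poly K}}) :
  (forall M, rho M \o @pr_const K V R =1 polyC) ->
  (forall M, rho M \o @pr_var K V R =1 z M) ->
  (forall M v, 'X^M %| z M.+1 v - z M v) ->
  prime_ideal (fun h => forall M, 'X^M %| rho M h).
Proof.
move=> rhoC rhoX z_compat.
have compat1 M h : 'X^M %| rho M.+1 h - rho M h.
  elim/(pr_ind (p := R)): h => [c|v|a b IHa IHb|a b IHa IHb].
  - by rewrite [rho _ _]rhoC [rho M _]rhoC subrr dvdp0.
  - by rewrite [rho _ _]rhoX [rho M _]rhoX.
  - by rewrite !rmorphD opprD addrACA dvdp_add.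
  - rewrite !rmorphM /=.
    have -> : rho M.+1 a * rho M.+1 b - rho M a * rho M b =
      (rho M.+1 a - rho M a) * rho M.+1 b + rho M a * (rho M.+1 b - rho M b).
      by ring.
    by apply: dvdp_add; [apply: dvdp_mulr | apply: dvdp_mull].
have compat M N h : (M <= N)%N -> 'X^M %| rho N h - rho M h.
  elim: N => [|N IHN]; first by rewrite leqn0 => /eqP->; rewrite subrr dvdp0.
  rewrite leq_eqVlt => /predU1P[->|]; first by rewrite subrr dvdp0.
  rewrite ltnS => le_MN; rewrite -(subrK (rho N h) (rho N.+1 h)) -addrA.
  by apply: dvdp_add; rewrite ?IHN // (dvdp_trans _ (compat1 N h)) // dvdp_exp2l.
split=> [M|a b Pa Pb M|a b Pb M|/(_ 1)|a b Pab].
- by rewrite rmorph0 dvdp0.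
- by rewrite rmorphD dvdp_add.
- by rewrite rmorphM dvdp_mull.
- by rewrite rmorph1 expr1 dvdp1 size_polyX.
have [Pa|/not_all_ex_not[M nPa]] := classic (forall M, 'X^M %| rho M a).
  by left.
(* If a vanishes to order less than M and b to order less than N along the arc,
   then a b vanishes to order less than M + N. *)
right=> N; apply/negPn/negP => nPb; pose T := (M + N)%N.
have lowered L h : (L <= T)%N -> ('X^L %| rho T h) = ('X^L %| rho L h).
  by move=> le_LT; rewrite -[RHS](dvdp_addr _ (compat _ _ h le_LT)) subrK.
have {}nPa : ~~ ('X^M %| rho T a) by rewrite lowered ?leq_addr //; apply/negP.
have {}nPb : ~~ ('X^N %| rho T b) by rewrite lowered ?leq_addl.
have a0 : rho T a != 0 by apply: contraNneq nPa => ->; rewrite dvdp0.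
have b0 : rho T b != 0 by apply: contraNneq nPb => ->; rewrite dvdp0.
have := Pab T; rewrite rmorphM -['X]subr0 -mup_geq ?mulf_neq0 // mupM //.
move: nPa nPb; rewrite -['X]subr0 -!mup_ltn // => lt_a lt_b.
rewrite leqNgt => /negP; apply; rewrite /T -addnS leq_add //; exact: ltnW.
Qed.

(** * Bivariate polynomials *)

Definition derivY (R : comNzRingType) (G : {poly {poly R}}) : {poly {poly R}} :=
  map_poly (@deriv R) G.

Definition hessian (R : comNzRingType) (G : {poly {poly R}}) : {poly {poly R}} :=
  G^`()^`() * derivY (derivY G) - derivY G^`() ^+ 2.

Lemma taylor1 (R : comNzRingType) (p : {poly R}) x e h :
  exists r, p.[x + e * h] = p.[x] + e * (h * p^`().[x]) + e ^+ 2 * r.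
Proof.
elim/poly_ind: p => [|p c [r IH]].
  by exists 0; rewrite deriv0 !horner0; ring.
exists (h * (h * p^`().[x]) + (x + e * h) * r).
by rewrite derivD derivM derivC derivX mulr1 addr0 !(hornerD, hornerM, hornerX,
  hornerC) IH; ring.
Qed.

Section Bivariate.

Variable R : comNzRingType.
Implicit Types (p : {poly R}) (G H : {poly {poly R}}).

Lemma derivYD G H : derivY (G + H) = derivY G + derivY H.
Proof. exact: raddfD. Qed.

Lemma derivYB G H : derivY (G - H) = derivY G - derivY H.
Proof. exact: raddfB. Qed.

Lemma derivY_sum (I : Type) (r : seq I) (P : pred I) (E : I -> {poly {poly R}}) :
  derivY (\sum_(i <- r | P i) E i) = \sum_(i <- r | P i) derivY (E i).
Proof. exact: raddf_sum. Qed.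

Lemma derivY_const p : derivY p%:P = p^`()%:P.
Proof. exact: map_polyC. Qed.

Lemma derivY_polyC p : derivY p^:P = 0.
Proof. by apply/polyP => i; rewrite coef0 !coef_map /= derivC. Qed.

Lemma derivYM_Xn G n : derivY (G * 'X^n) = derivY G * 'X^n.
Proof.
apply/polyP => i; rewrite coefMXn !coef_map /= coefMXn.
by case: ifP => _; rewrite ?deriv0 ?coef_map.
Qed.

Lemma deriv_derivY G : derivY G^`() = (derivY G)^`().
Proof.
by apply/polyP => i; rewrite coef_deriv !coef_map /= coef_deriv derivMn.
Qed.

Lemma deriv_horner_const G (x : R) : G.[x%:P]^`() = (derivY G).[x%:P].
Proof.
elim/poly_ind: G => [|G c IH]; first by rewrite /derivY raddf0 !horner0 deriv0.
rewrite derivYD derivY_const -['X]expr1 derivYM_Xn expr1.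
rewrite !(hornerD, hornerM, hornerX, hornerC) derivD derivM.
by rewrite IH derivC mulr0 addr0.
Qed.

Lemma horner2_map (S : comNzRingType) (f : {rmorphism R -> S}) G x y :
  (map_poly (map_poly f) G).[f x, f y] = f G.[x, y].
Proof. by rewrite -map_polyC horner_map horner_map. Qed.

Lemma derivY_map (S : comNzRingType) (f : {rmorphism R -> S}) G :
  derivY (map_poly (map_poly f) G) = map_poly (map_poly f) (derivY G).
Proof. by apply/polyP => i; rewrite !coef_map /= deriv_map. Qed.

Lemma hessian_map (S : comNzRingType) (f : {rmorphism R -> S}) G :
  hessian (map_poly (map_poly f) G) = map_poly (map_poly f) (hessian G).
Proof.
by rewrite /hessian rmorphB rmorphM rmorphXn /= !deriv_map !derivY_map.
Qed.

(** The first-order Taylor formula in two variables is that of one variable, used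
    first for the outer variable over {poly R} and then for the inner one. *)
Lemma taylor2 G x y e h k :
  exists r, G.[x + e * h, y + e * k] =
    G.[x, y] + e * (h * G^`().[x, y] + k * (derivY G).[x, y]) + e ^+ 2 * r.
Proof.
have [r1] := @taylor1 _ G x%:P e%:P h%:P; rewrite -polyCM -polyCD => ->.
have [r2 E2] := taylor1 G.[x%:P] y e k.
have [r3 E3] := taylor1 G^`().[x%:P] y e k.
rewrite deriv_horner_const in E2.
exists (r2 + h * (k * (G^`().[x%:P])^`().[y] + e * r3) + r1.[y + e * k]).
by rewrite -polyC_exp !(hornerD, hornerM, hornerC) E2 E3; ring.
Qed.

End Bivariate.

(** * Dickson polynomials *)

(** Chebyshev polynomials, normalised to be monic: D_n(z + 1/z) = z^n + 1/z^n. *)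
Fixpoint dickson (R : nzRingType) (n : nat) : {poly R} :=
  match n with
  | 0 => 2%:R
  | m.+1 => if m is k.+1 then 'X * dickson R m - dickson R k else 'X
  end.

Section Dickson.

Variable K : fieldType.
Local Notation D := (dickson K).

Lemma dicksonSS n : D n.+2 = 'X * D n.+1 - D n.
Proof. by []. Qed.

Lemma dickson_ind2 (Q : nat -> Prop) :
  Q 0 -> Q 1 -> (forall n, Q n -> Q n.+1 -> Q n.+2) -> forall n, Q n.
Proof.
move=> Q0 Q1 QS n; suff [] : Q n /\ Q n.+1 by [].
by elim: n => // n [Qn QSn]; split=> //; apply: QS.
Qed.

Lemma dickson_lead n : (size (D n - 'X^n)%R <= n.-1.+1)%N.
Proof.
elim/dickson_ind2: n => [||n IH1 IH2].
- by rewrite expr0 [D 0]mulr2n addrK size_poly1.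
- by rewrite subrr size_poly0.
have -> : D n.+2 - 'X^(n.+2) =
    'X * (D n.+1 - 'X^(n.+1)) - (D n - 'X^n) - 'X^n.
  by rewrite dicksonSS exprSr exprSr; ring.
apply: leq_trans (size_polyD _ _) _; rewrite geq_max size_polyN size_polyXn leqnSn.
rewrite andbT; apply: leq_trans (size_polyD _ _) _; rewrite geq_max size_polyN.
apply/andP; split; last by apply: leq_trans IH1 _; lia.
by apply: leq_trans (size_polyMleq _ _) _; rewrite size_polyX /= ltnS.
Qed.

Lemma size_dickson n : (0 < n)%N -> size (D n) = n.+1.
Proof.
move=> n_gt0; rewrite -[D n](subrK 'X^n) addrC size_polyDl ?size_polyXn //.
by rewrite ltnS; apply: leq_trans (dickson_lead n) _; rewrite prednK.
Qed.

Lemma dickson_monic n : (0 < n)%N -> D n \is monic.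
Proof.
move=> n_gt0; rewrite monicE -[D n](subrK 'X^n) addrC lead_coefDl.
  by rewrite lead_coefXn.
by rewrite size_polyXn ltnS; apply: leq_trans (dickson_lead n) _; rewrite prednK.
Qed.

Section AtSum.

Variable z : K.
Hypothesis z0 : z != 0.
Let x := z + z^-1.
Let w := z - z^-1.
Let s n := z ^+ n + z ^- n.
Let d n := z ^+ n - z ^- n.

Let zV : z * z^-1 = 1. Proof. exact: divff. Qed.

Let s_rec n : s n.+2 = x * s n.+1 - s n.
Proof.
rewrite /s /x !exprS !invfM; move: (z ^+ n) (z ^- n) => a c.
move: z^-1 zV => b zb; apply/eqP; rewrite -subr_eq0.
have -> : z * (z * a) + b * (b * c) - ((z + b) * (z * a + b * c) - (a + c)) =
  (1 - z * b) * (a + c) by ring.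
by rewrite zb subrr mul0r.
Qed.

Let d_rec n : d n.+2 = x * d n.+1 - d n.
Proof.
rewrite /d /x !exprS !invfM; move: (z ^+ n) (z ^- n) => a c.
move: z^-1 zV => b zb; apply/eqP; rewrite -subr_eq0.
have -> : z * (z * a) - b * (b * c) - ((z + b) * (z * a - b * c) - (a - c)) =
  (1 - z * b) * (a - c) by ring.
by rewrite zb subrr mul0r.
Qed.

Let ws n : w * s n = 2%:R * d n.+1 - x * d n.
Proof.
rewrite /w /s /d /x !exprS !invfM; move: (z ^+ n) (z ^- n) => a c.
by move: z^-1 => b; ring.
Qed.

Let wsS n : w * s n.+1 = x * d n.+1 - 2%:R * d n.
Proof. by rewrite ws d_rec; ring. Qed.

Let w2 : w ^+ 2 = x ^+ 2 - 4%:R.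
Proof.
rewrite /w /x; have -> : (z + z^-1) ^+ 2 - 4%:R =
  (z - z^-1) ^+ 2 + 4%:R * (z * z^-1 - 1) by ring.
by rewrite zV subrr mulr0 addr0.
Qed.

Lemma dickson_sum n : (D n).[x] = s n.
Proof.
elim/dickson_ind2: n => [||n IH1 IH2].
- by rewrite /s expr0 invr1 hornerMn hornerC.
- by rewrite /s hornerX expr1.
by rewrite dicksonSS hornerD hornerM hornerX hornerN IH1 IH2 s_rec.
Qed.

(** Differentiate D_n(z + 1/z) = z^n + z^-n with respect to z and multiply by z. *)
Lemma dickson_deriv_sum n : (z - z^-1) * (D n)^`().[x] = n%:R * d n.
Proof.
rewrite -/w; elim/dickson_ind2: n => [||n IH1 IH2].
- by rewrite derivMn derivC mul0rn horner0 mulr0 mul0r.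
- by rewrite derivX hornerC /d expr1 mulr1 mul1r.
rewrite dicksonSS derivB derivM derivX mul1r !(hornerD, hornerN, hornerM, hornerX).
rewrite mulrBr mulrDr dickson_sum IH1 mulrCA IH2 wsS d_rec -!natr1.
by move: (x) (d n.+1) (d n) n%:R => ? ? ? ?; ring.
Qed.

(** Differentiate D_n(z + 1/z) = z^n + z^-n twice with respect to z, and eliminate
    the first derivative of D_n by [dickson_deriv_sum]. *)
Lemma dickson_deriv2_sum n :
  (z - z^-1) ^+ 3 * (D n)^`()^`().[x] =
    (z - z^-1) * s n * n%:R ^+ 2 - (z + z^-1) * d n * n%:R.
Proof.
rewrite -/w -/x; elim/dickson_ind2: n => [||n IH1 IH2].
- by rewrite derivMn derivC mul0rn derivC horner0 !(mulr0, expr2) subrr.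
- by rewrite derivX derivC horner0 /s /d /w /x !expr1; ring.
rewrite dicksonSS derivB derivM derivX mul1r derivB derivD derivM derivX mul1r.
rewrite !(hornerD, hornerN, hornerM, hornerX) mulrBr IH1.
have -> (f g : K) : w ^+ 3 * (f + (f + x * g)) =
    2%:R * w ^+ 2 * (w * f) + x * (w ^+ 3 * g).
  by ring.
rewrite IH2 dickson_deriv_sum -/(d n.+1) s_rec [w * (_ - _)]mulrBr.
rewrite [w * (x * _)]mulrCA !wsS !ws d_rec w2 -!natr1.
by move: (x) (d n.+1) (d n) n%:R => ? ? ? ?; ring.
Qed.

End AtSum.
End Dickson.

Lemma closed_prim_root (K : closedFieldType) n :
  (0 < n)%N -> n%:R != 0 :> K -> exists z : K, n.-primitive_root z.
Proof.
move=> n_gt0 n0; have [rs] := closed_field_poly_normal ('X^n - 1 : {poly K}).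
have -> : lead_coef ('X^n - 1 : {poly K}) = 1 by apply/eqP/monicXnsubC.
rewrite scale1r => rsE.
suff /hasP[z _ zP] : has n.-primitive_root rs by exists z.
apply: has_prim_root => //.
- apply/allP => z rz; rewrite /root_of_unity rsE root_prod_XsubC; exact: rz.
- by rewrite -separable_prod_XsubC -rsE separable_Xn_sub_1.
- by rewrite -ltnS -(size_prod_XsubC rs id) -rsE size_XnsubC.
Qed.

(** For a primitive 2n-th root of unity zeta and 0 < i < n these are the critical
    points of D_n, the analogue of 2 cos(i pi / n). *)
Definition crit_pt (K : fieldType) (zeta : K) (i : nat) : K :=
  zeta ^+ i + zeta ^- i.

Section CriticalPoints.

Variables (K : fieldType) (n : nat) (zeta : K).
Hypothesis zeta_prim : (2 * n)%N.-primitive_root zeta.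

Let n_gt0 : (0 < n)%N.
Proof. by have := prim_order_gt0 zeta_prim; rewrite muln_gt0. Qed.

Let zeta0 : zeta != 0.
Proof. by rewrite (prim_root_eq0 zeta_prim) -lt0n muln_gt0. Qed.

Let two0 : 2%:R != 0 :> K.
Proof. by apply: (prim_root_dvd_eq0 zeta_prim); rewrite dvdn_mulr. Qed.

Let natn0 : n%:R != 0 :> K.
Proof. by apply: (prim_root_dvd_eq0 zeta_prim); rewrite dvdn_mull. Qed.

Lemma zeta_half : zeta ^+ n = -1.
Proof.
have /eqP : (zeta ^+ n) ^+ 2 = 1 by rewrite -exprM mulnC (prim_expr_order zeta_prim).
rewrite sqrf_eq1 -(prim_order_dvd zeta_prim) => /orP[/dvdn_leq|/eqP //].
by move=> /(_ n_gt0); lia.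
Qed.

Lemma crit_pt_inj i j : (0 < i < n)%N -> (0 < j < n)%N ->
  crit_pt zeta i = crit_pt zeta j -> i = j.
Proof.
move=> lt_i lt_j /eqP; rewrite -subr_eq0 /crit_pt.
have zi0 := expf_neq0 i zeta0; have zj0 := expf_neq0 j zeta0.
(* z + 1/z = w + 1/w only if w is z or 1/z. *)
have -> : zeta ^+ i + zeta ^- i - (zeta ^+ j + zeta ^- j) =
    (zeta ^+ i - zeta ^+ j) * (zeta ^+ (i + j) - 1) / zeta ^+ (i + j).
  rewrite exprD; move: (zeta ^+ i) (zeta ^+ j) zi0 zj0 => a b a0 b0.
  by field; rewrite a0 b0.
rewrite !mulf_eq0 invr_eq0 expf_eq0 (negPf zeta0) andbF orbF !subr_eq0.
rewrite (eq_prim_root_expr zeta_prim) -(prim_order_dvd zeta_prim).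
case/orP=> [|/dvdn_leq]; last by lia.
by rewrite !modn_small; [move/eqP | lia | lia].
Qed.

(** Reduce m modulo 2n, and replace it by 2n - m if it exceeds n: both operations
    preserve its parity, which decides the critical value. *)
Lemma crit_pt_exists m : ~~ (n %| m)%N ->
  exists i, [/\ (0 < i < n)%N, odd i = odd m & crit_pt zeta i = crit_pt zeta m].
Proof.
move=> n_m; pose r := (m %% (2 * n))%N.
have crit_r : crit_pt zeta r = crit_pt zeta m.
  by rewrite /crit_pt (prim_expr_mod zeta_prim).
have m_eq : m = (m %/ (2 * n) * (2 * n) + r)%N by rewrite -divn_eq.
have odd_r : odd r = odd m by rewrite [in RHS]m_eq oddD !oddM andbF.
have lt_r : (r < 2 * n)%N by rewrite ltn_mod muln_gt0.
have n_r : ~~ (n %| r)%N.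
  by apply: contra n_m; rewrite m_eq => n_r; rewrite dvdn_add // mulnA dvdn_mull.
have r_n : r != n by apply: contraNneq n_r => ->.
have r_0 : r != 0%N by apply: contraNneq n_r => ->.
have [lt_rn|le_nr] := ltnP r n; first by exists r; split=> //; lia.
exists (2 * n - r)%N; split; first lia.
  by rewrite oddB ?oddM //; lia.
rewrite -crit_r /crit_pt expfB // (prim_expr_order zeta_prim).
by rewrite div1r invrK addrC.
Qed.

Section AtCriticalPoint.

Variable i : nat.
Hypothesis lt_i : (0 < i < n)%N.

Let z0 : zeta ^+ i != 0. Proof. exact: expf_neq0. Qed.

Let zn : (zeta ^+ i) ^+ n = (-1) ^+ i.
Proof. by rewrite -exprM mulnC exprM zeta_half. Qed.

Let sgnV : ((-1) ^+ i)^-1 = (-1) ^+ i :> K.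
Proof. by rewrite -exprVn invrN1. Qed.

Let w0 : zeta ^+ i - (zeta ^+ i)^-1 != 0.
Proof.
rewrite subr_eq0; apply/negP => /eqP zz.
have : zeta ^+ (2 * i) == 1 by rewrite mulnC exprM expr2 {2}zz divff.
by rewrite -(prim_order_dvd zeta_prim) => /dvdn_leq; lia.
Qed.

Lemma dickson_crit_val : (dickson K n).[crit_pt zeta i] = (-1) ^+ i * 2%:R.
Proof. by rewrite /crit_pt dickson_sum // zn sgnV -mulr2n mulr_natr. Qed.

Lemma dickson_crit : (dickson K n)^`().[crit_pt zeta i] = 0.
Proof.
apply: (mulfI w0); rewrite dickson_deriv_sum // zn sgnV subrr.
by rewrite !mulr0.
Qed.

Lemma dickson_crit_nondeg : (dickson K n)^`()^`().[crit_pt zeta i] != 0.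
Proof.
apply/eqP => D0; have := dickson_deriv2_sum z0 n.
rewrite D0 mulr0 zn sgnV subrr mulr0 mul0r subr0 -mulr2n => /esym/eqP.
apply/negP; rewrite -[_ *+ 2]mulr_natr.
by apply: mulf_neq0; rewrite ?expf_neq0 // !mulf_neq0 // expf_neq0 ?oppr_eq0 ?oner_eq0.
Qed.

End AtCriticalPoint.

End CriticalPoints.

(** * The nodes of the Chebyshev curve impose independent conditions *)

(** In a linear combination of polynomials of distinct degrees the leading term of
    the largest one cannot cancel. *)
Lemma monic_free (R : nzRingType) (T : finType) (S : {set T})
    (g : T -> {poly R}) (c : T -> R) :
  (forall m, m \in S -> g m \is monic) -> {in S &, injective (size \o g)} ->
  \sum_(m in S) c m *: g m = 0 -> forall m, m \in S -> c m = 0.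
Proof.
move=> g_monic g_inj g0 m mS; apply/eqP; apply: contraTT isT => cm0.
have [k /andP[kS ck0] k_max] :=
  @arg_maxnP _ m (fun m => (m \in S) && (c m != 0)) (size \o g)
    (introT andP (conj mS cm0)).
have : (\sum_(m in S) c m *: g m)`_(size (g k)).-1 = c k.
  rewrite coef_sum (bigD1 k) //= coefZ -lead_coefE (monicP (g_monic k kS)) mulr1.
  rewrite big1 ?addr0 // => i /andP[iS i_k]; rewrite coefZ.
  have [->|ci0] := eqVneq (c i) 0; first by rewrite mul0r.
  rewrite nth_default ?mulr0 //.
  have := k_max i; rewrite iS ci0 => /(_ isT) /=; rewrite leq_eqVlt => /predU1P[|lt].
    by move=> /(g_inj _ _ iS kS) /eqP; rewrite (negPf i_k).
  by move: lt; case: (size (g k)).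
by rewrite g0 coef0 => /esym ck; rewrite ck eqxx in ck0.
Qed.

Section ChebyshevNodes.

Variables (K : fieldType) (p q : nat) (omega : K).
Hypotheses (p_gt1 : (1 < p)%N) (q_gt1 : (1 < q)%N) (co_pq : coprime p q).
Hypothesis omega_prim : (2 * (p * q))%N.-primitive_root omega.

Local Notation J := ('I_q.-1 * 'I_p.-1)%type.
Local Notation T := ('I_q * 'I_p)%type.

Definition crit_x (j : J) : K := crit_pt (omega ^+ p) j.1.+1.
Definition crit_y (j : J) : K := crit_pt (omega ^+ q) j.2.+1.

(** The critical values of D_q at [crit_x j] and of D_p at [crit_y j] are 2 or -2
    according to the parity of the indices, so these are the critical points of
    D_p(Y) - D_q(X) that lie on the curve. *)
Definition node_index : {set J} := [set j : J | odd j.1 == odd j.2].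

(** The exponents of the adjoint polynomials of the curve.  The form dX / F_Y has a
    zero of order 2d - 2 at infinity, where X^i Y^k has a pole of order i p + k q,
    so the differential X^i Y^k dX / F_Y is regular there if this weight is at most
    2d - 2; and no weight is equal to pq - p - q = 2d - 1. *)
Definition adjoint_exps : {set T} :=
  [set m : T | m.1 * p + m.2 * q + (p + q) <= p * q]%N.

Let p_gt0 : (0 < p)%N. Proof. exact: ltnW. Qed.
Let q_gt0 : (0 < q)%N. Proof. exact: ltnW. Qed.

Lemma prim_root_x : (2 * q)%N.-primitive_root (omega ^+ p).
Proof.
have := dvdn_prim_root omega_prim (_ : (2 * q %| 2 * (p * q))%N).
by rewrite mulnCA mulnK ?muln_gt0 // => ->; rewrite // dvdn_mull.
Qed.

Lemma prim_root_y : (2 * p)%N.-primitive_root (omega ^+ q).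
Proof.
have := dvdn_prim_root omega_prim (_ : (2 * p %| 2 * (p * q))%N).
by rewrite mulnA mulKn ?muln_gt0 // => ->; rewrite // dvdn_mulr.
Qed.

Let omega0 : omega != 0.
Proof. by rewrite (prim_root_eq0 omega_prim) -lt0n !muln_gt0 p_gt0 q_gt0. Qed.

Lemma dickson_crit_pt a m :
  (dickson K a).[crit_pt omega m] = crit_pt (omega ^+ a) m.
Proof.
by rewrite /crit_pt dickson_sum ?expf_neq0 // -!exprM mulnC.
Qed.

(** The curve is parametrised by t |-> (D_p(t), D_q(t)), because D_q(D_p(t)) and
    D_p(D_q(t)) are both D_pq(t).  The critical points t of D_pq that are neither
    critical for D_p nor for D_q are the parameters of the branches at the nodes. *)
Lemma branch_param_node m : ~~ (p %| m)%N -> ~~ (q %| m)%N ->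
  exists2 j, j \in node_index &
    (dickson K p).[crit_pt omega m] = crit_x j /\
    (dickson K q).[crit_pt omega m] = crit_y j.
Proof.
move=> p_m q_m.
have [i [lt_i odd_i xi]] := crit_pt_exists prim_root_x q_m.
have [k [lt_k odd_k yk]] := crit_pt_exists prim_root_y p_m.
have lt_i' : (i.-1 < q.-1)%N by lia.
have lt_k' : (k.-1 < p.-1)%N by lia.
exists (Ordinal lt_i', Ordinal lt_k').
  by rewrite inE /=; apply/eqP; lia.
rewrite !dickson_crit_pt -xi -yk /crit_x /crit_y /= !prednK //; lia.
Qed.

(** By the Chinese remainder theorem there are (p - 1)(q - 1) = 2d such parameters,
   two for each node. *)
Let branch (j : J) : nat := (chinese q p j.1.+1 j.2.+1 %% (p * q))%N.

Let branch_modq j : (branch j %% q = j.1.+1)%N.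
Proof.
rewrite /branch modn_dvdm ?dvdn_mull // chinese_modl 1?coprime_sym // modn_small //.
by have := ltn_ord j.1; lia.
Qed.

Let branch_modp j : (branch j %% p = j.2.+1)%N.
Proof.
rewrite /branch modn_dvdm ?dvdn_mulr // chinese_modr 1?coprime_sym // modn_small //.
by have := ltn_ord j.2; lia.
Qed.

Let branch_range j : (0 < branch j < p * q)%N.
Proof.
rewrite ltn_mod muln_gt0 p_gt0 q_gt0 !andbT lt0n; apply/eqP => b0.
by have := branch_modp j; rewrite b0 mod0n.
Qed.

(** An adjoint polynomial, restricted to the parametrisation, has degree at most
    2d - 1 in t, but if it vanishes at the nodes it has the 2d roots indexed by [branch];
    so it vanishes on the curve, and hence is zero because its monomials
    restrict to polynomials in t of distinct degrees. *)
Lemma adjoint_vanish (c : T -> K) :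
  (forall j, j \in node_index ->
    \sum_(m in adjoint_exps) c m * (crit_x j ^+ m.1 * crit_y j ^+ m.2) = 0) ->
  forall m, m \in adjoint_exps -> c m = 0.
Proof.
move=> c0; pose g (m : T) := dickson K p ^+ m.1 * dickson K q ^+ m.2.
have g_monic m : g m \is monic by rewrite monicMr ?monic_exp ?dickson_monic.
have size_g m : size (g m) = (m.1 * p + m.2 * q).+1.
  rewrite size_monicM ?monic_exp ?dickson_monic ?monic_neq0 //; last first.
    by rewrite monic_exp ?dickson_monic.
  have sizeX a e : (0 < a)%N -> size (dickson K a ^+ e) = (e * a).+1.
    move=> a0; rewrite polySpred ?monic_neq0 ?monic_exp ?dickson_monic //.
    by rewrite size_exp size_dickson //= mulnC.
  by rewrite !sizeX //= addnS.
apply: (monic_free (g := g)) => // [[i k] [i' k'] _ _|].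
  rewrite /= !size_g /= => -[ik].
  have ik2 : (i * p = i' * p %[mod q])%N.
    by rewrite -(modnMDl k) addnC ik addnC modnMDl.
  have ii : i = i'.
    have modM_inj (a b : nat) : (a <= b)%N -> (b < q)%N ->
        (b * p = a * p %[mod q])%N -> b = a.
      move=> le_ab lt_bq /eqP; rewrite eqn_mod_dvd ?leq_mul2r ?le_ab ?orbT //.
      rewrite -mulnBl Gauss_dvdl 1?coprime_sym // => q_ba.
      apply/eqP; rewrite eqn_leq le_ab andbT -subn_eq0 -leqn0 leqNgt.
      by apply/negP => /dvdn_leq/(_ q_ba); rewrite leqNgt ltn_subLR // ltn_addl.
    apply: val_inj; case/orP: (leq_total i i') => [le|ge].
      exact/esym/(modM_inj _ _ le (ltn_ord i') (esym ik2)).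
    exact: (modM_inj _ _ ge (ltn_ord i) ik2).
  rewrite -ii in ik *; congr (_, _); apply/val_inj/eqP.
  by rewrite -(eqn_pmul2r q_gt0) -(eqn_add2l (i * p)%N) ik.
set h := (X in X = 0); apply/eqP; apply: contraT => h0.
pose t j := crit_pt omega (branch j).
have t_inj : injective t.
  move=> j j' /(crit_pt_inj omega_prim (branch_range j) (branch_range j')) bb.
  have := branch_modp j; rewrite bb branch_modp => -[jj2].
  have := branch_modq j; rewrite bb branch_modq => -[jj1].
  by case: j j' jj1 jj2 {bb} => [i k] [i' k'] /= /val_inj-> /val_inj->.
have h_root : all (root h) [seq t j | j <- enum [set: J]].
  apply/allP => _ /mapP[j _ ->]; apply/eqP.
  have [|| j' j'N [xE yE]] := @branch_param_node (branch j).
  - by rewrite /dvdn branch_modp.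
  - by rewrite /dvdn branch_modq.
  rewrite -[RHS](c0 j' j'N) horner_sum; apply: eq_bigr => m _.
  by rewrite hornerZ hornerM !horner_exp xE yE.
have := max_poly_roots h0 h_root; rewrite map_inj_uniq ?enum_uniq // => /(_ isT).
rewrite size_map -cardE cardsT card_prod !card_ord ltnNge => /negP[].
apply: leq_trans (size_sum _ _ _) _; apply/bigmax_leqP => m; rewrite inE => mS.
apply: leq_trans (size_scale_leq _ _) _; rewrite size_g.
have -> : (q.-1 * p.-1 = (p * q - (p + q)).+1)%N by clear -p_gt1 q_gt1; nia.
by clear -mS; lia.
Qed.

(** Half of the exponents (i, k) of the box i < q - 1, k < p - 1, at least, have
    small weight: the central symmetry of the box exchanges small and large. *)
Lemma card_adjoint_exps : (q.-1 * p.-1 <= 2 * #|adjoint_exps|)%N.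
Proof.
have le_q : (q.-1 <= q)%N by rewrite leq_pred.
have le_p : (p.-1 <= p)%N by rewrite leq_pred.
pose f (j : J) : T := (widen_ord le_q j.1, widen_ord le_p j.2).
have f_inj : injective f.
  move=> [i k] [i' k'] /= [/= /val_inj ii /val_inj kk].
  by rewrite ii kk.
pose A := [set j : J | f j \in adjoint_exps].
have le_A : (#|A| <= #|adjoint_exps|)%N.
  rewrite -(card_imset _ f_inj) subset_leq_card //.
  by apply/subsetP => _ /imsetP[j + ->]; rewrite inE.
pose r (j : J) : J := (rev_ord j.1, rev_ord j.2).
have r_inj : injective r.
  by apply: (inv_inj (f := r)) => -[i k]; rewrite /r /= !rev_ordK.
have : ([set: J] \subset A :|: r @^-1: A).
  apply/subsetP => -[i k] _; rewrite !inE /=.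
  have := ltn_ord i; have := ltn_ord k; clear; nia.
move=> /subset_leq_card; rewrite cardsT card_prod !card_ord => le_J.
apply: leq_trans le_J _; apply: leq_trans (leq_card_setU _ _) _.
by rewrite card_preimset // mul2n -addnn leq_add.
Qed.

(** One of p and q is odd; reversing the order of the corresponding indices changes
    their parity, and so sends nodes to critical points off the curve. *)
Lemma card_node_index : (2 * #|node_index| <= q.-1 * p.-1)%N.
Proof.
pose r (j : J) : J :=
  if odd q then (rev_ord j.1, j.2) else (j.1, rev_ord j.2).
have r_inj : injective r.
  apply: (inv_inj (f := r)) => -[i k].
  by rewrite /r; case: (odd q); rewrite /= rev_ordK.
have disj : [disjoint node_index & r @^-1: node_index].
  rewrite -setI_eq0; apply/eqP/setP => -[i k]; rewrite !inE /r.
  have odd_pq : odd p || odd q.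
    apply: contraLR co_pq; rewrite negb_or /coprime => /andP[p2 q2].
    apply/negP => /eqP g1; have : (2 %| gcdn p q)%N by rewrite dvdn_gcd !dvdn2 p2.
    by rewrite g1.
  have := ltn_ord i; have := ltn_ord k.
  case: ifP => q_odd /=; clear -p_gt1 q_gt1 q_odd odd_pq; lia.
rewrite mul2n -addnn -{2}(card_preimset _ r_inj).
have := leq_card_setU node_index (r @^-1: node_index); rewrite disj => /leqifP.
move=> /eqP <-; rewrite (leq_trans (max_card _)) // card_prod !card_ord //.
Qed.

End ChebyshevNodes.

(** Functions e m that are linearly independent on N are at most #|N| in number,
    and if they are as many they interpolate any values on N; the section sigma
    makes the interpolant a function of the values. *)
Lemma interpolation_section (K : fieldType) (T J : finType)
    (S : {set T}) (N : {set J}) (e : T -> J -> K) :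
  (#|N| <= #|S|)%N ->
  (forall c : T -> K, (forall j, j \in N -> \sum_(m in S) c m * e m j = 0) ->
     forall m, m \in S -> c m = 0) ->
  (#|S| <= #|N|)%N /\ exists sigma : (J -> K) -> (T -> K), forall t j, j \in N ->
    \sum_(m in S) sigma t m * e m j = t j.
Proof.
move=> le_NS e_free.
pose E := \matrix_(a < #|S|, b < #|N|) e (enum_val a) (enum_val b).
pose spread (v : 'rV[K]_#|S|) (m : T) : K :=
  \sum_a (if enum_val a == m then v 0 a else 0).
have spreadE v a : spread v (enum_val a) = v 0 a.
  rewrite /spread (bigD1 a) //= eqxx big1 ?addr0 // => b b_a.
  by rewrite (inj_eq enum_val_inj) (negPf b_a).
have sumE v b :
    \sum_(m in S) spread v m * e m (enum_val b) = (v *m E) 0 b.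
  rewrite big_enum_val mxE; apply: eq_bigr => a _.
  by rewrite spreadE mxE.
have E_free : row_free E.
  apply: inj_row_free => v vE; apply/rowP => a; rewrite mxE -spreadE.
  apply: e_free (enum_valP a) => j jN.
  by rewrite -(enum_rankK_in jN jN) sumE vE mxE.
have E_full : row_full E.
  by rewrite /row_full eqn_leq rank_leq_col (eqP E_free).
split; first by rewrite -(eqP E_free) rank_leq_col.
exists (fun t => spread (\row_b t (enum_val b) *m pinvmx E)) => t j jN.
rewrite -{1}(enum_rankK_in jN jN) sumE mulmxKpV ?submx_full // mxE.
by rewrite (enum_rankK_in jN jN).
Qed.

(** * The family of normed Weierstrass polynomials *)

Section Weierstrass.

Variables (p q : nat).

Definition low_part (R : comNzRingType) (A : 'I_q -> 'I_p -> R) :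
    {poly {poly R}} :=
  \sum_(nu < q) \sum_(mu < p | (nu * p + mu * q < p * q)%N)
     (A nu mu)%:P%:P * 'X ^+ nu * 'Y ^+ mu.

Definition weierstrass (R : comNzRingType) (A : 'I_q -> 'I_p -> R) :
    {poly {poly R}} :=
  'Y ^+ p - 'X ^+ q + low_part A.

Lemma low_part_map (R S : comNzRingType) (f : {rmorphism R -> S}) A :
  map_poly (map_poly f) (low_part A) = low_part (fun nu mu => f (A nu mu)).
Proof.
rewrite rmorph_sum; apply: eq_bigr => nu _; rewrite rmorph_sum.
apply: eq_bigr => mu _; rewrite !rmorphM !rmorphXn /= map_polyX.
by rewrite !map_polyC /= map_polyC map_polyX.
Qed.

Lemma weierstrass_map (R S : comNzRingType) (f : {rmorphism R -> S}) A :
  map_poly (map_poly f) (weierstrass A) =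
    weierstrass (fun nu mu => f (A nu mu)).
Proof.
rewrite rmorphD rmorphB !rmorphXn /= low_part_map map_polyX map_polyC /=.
by rewrite map_polyX.
Qed.

Section OneRing.

Variable R : comNzRingType.
Implicit Types A B : 'I_q -> 'I_p -> R.

Lemma low_part_horner A x y :
  (low_part A).[x, y] =
    \sum_(nu < q) \sum_(mu < p | (nu * p + mu * q < p * q)%N)
       A nu mu * (x ^+ nu * y ^+ mu).
Proof.
rewrite !horner_sum; apply: eq_bigr => nu _; rewrite !horner_sum.
apply: eq_bigr => mu _; rewrite !(hornerM, horner_exp, hornerX, hornerC).
by rewrite mulrA.
Qed.

Lemma weierstrassD e A B :
  weierstrass (fun nu mu => A nu mu + e * B nu mu) =
    weierstrass A + e%:P%:P * low_part B.
Proof.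
rewrite /weierstrass -[RHS]addrA; congr (_ + _); rewrite /low_part mulr_sumr -big_split.
apply: eq_bigr => nu _ /=; rewrite mulr_sumr -big_split; apply: eq_bigr => mu _ /=.
by rewrite !polyCD !polyCM; ring.
Qed.

Lemma derivYCM c (G : {poly {poly R}}) :
  derivY (c%:P%:P * G) = c%:P%:P * derivY G.
Proof.
by apply/polyP => i; rewrite coefCM !coef_map /= coefCM derivM derivC mul0r add0r.
Qed.

End OneRing.

Lemma weierstrass_separated (K : comNzRingType) (f g : {poly K}) :
  (0 < p)%N -> (0 < q)%N ->
  (size (f - 'X^p)%R <= p)%N -> (size (g - 'X^q)%R <= q)%N ->
  exists A : 'I_q -> 'I_p -> K, weierstrass A = f%:P - g^:P.
Proof.
move=> p0 q0 size_f size_g.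
pose a := f - 'X^p; pose b := g - 'X^q.
exists (fun nu mu => (if nu == 0%N :> nat then a`_mu else 0) -
                     (if mu == 0%N :> nat then b`_nu else 0)).
have polyE n (h : {poly K}) : (size h <= n)%N -> h = \sum_(i < n) h`_i *: 'X^i.
  move=> size_h; rewrite -(poly_def n (fun i => h`_i)); apply/polyP => i.
  by rewrite coef_poly; case: ltnP => // le_ni; rewrite nth_default ?(leq_trans size_h).
have f_part : \sum_(nu < q) \sum_(mu < p | (nu * p + mu * q < p * q)%N)
    (if nu == 0%N :> nat then a`_mu else 0)%:P%:P * 'X ^+ nu * 'Y ^+ mu = a%:P.
  rewrite (bigD1 (Ordinal q0)) //= [X in _ + X]big1 ?addr0; last first.
    move=> nu nu0; apply: big1 => mu _; rewrite ifN ?mul0r //.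
  rewrite (eq_bigl xpredT) => [|mu]; last by rewrite mul0n add0n ltn_pmul2r ?ltn_ord.
  rewrite [in RHS](polyE p a size_f) rmorph_sum; apply: eq_bigr => mu _.
  by rewrite expr0 mulr1 -mul_polyC rmorphM rmorphXn.
have g_part : \sum_(nu < q) \sum_(mu < p | (nu * p + mu * q < p * q)%N)
    (if mu == 0%N :> nat then b`_nu else 0)%:P%:P * 'X ^+ nu * 'Y ^+ mu = b^:P.
  rewrite [in RHS](polyE q b size_g) rmorph_sum; apply: eq_bigr => nu _ /=.
  rewrite (bigD1 (Ordinal p0)) //=; last by rewrite mul0n addn0 mulnC ltn_pmul2l.
  rewrite big1 ?addr0 => [|mu /andP[_ mu0]]; last first.
    by rewrite ifN ?mul0r.
  by rewrite expr0 mulr1 map_polyZ map_polyXn mul_polyC.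
have -> : f%:P - g^:P = 'Y ^+ p - 'X ^+ q + (a%:P - b^:P).
  rewrite /a /b !rmorphB !rmorphXn /= map_polyX; ring.
rewrite /weierstrass -f_part -g_part -sumrB; congr (_ + _); apply: eq_bigr => nu _.
rewrite -sumrB; apply: eq_bigr => mu _.
by rewrite !polyCB; ring.
Qed.

End Weierstrass.

(** * Formal deformations with prescribed critical values *)

Section MarkedCurves.

Variables (p q : nat) (J : finType).

(** A single type of coordinates for curves with marked points makes a curve over K,
    its formal deformations and the generic curve functions on the same finite
    type, which ring morphisms act on by composition. *)
Definition coord : finType := (('I_q * 'I_p) + (J + J))%type.

Definition curve_of (R : comNzRingType) (z : coord -> R) : {poly {poly R}} :=
  weierstrass (fun (nu : 'I_q) (mu : 'I_p) => z (inl (nu, mu))).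

Definition at_mark (R : comNzRingType) (z : coord -> R) (j : J)
    (G : {poly {poly R}}) : R :=
  G.[z (inr (inl j)), z (inr (inr j))].

Lemma curve_of_map (R S : comNzRingType) (f : {rmorphism R -> S})
    (z : coord -> R) :
  map_poly (map_poly f) (curve_of z) = curve_of (f \o z).
Proof. exact: weierstrass_map. Qed.

Lemma at_mark_map (R S : comNzRingType) (f : {rmorphism R -> S})
    (z : coord -> R) j (G : {poly {poly R}}) :
  f (at_mark z j G) = at_mark (f \o z) j (map_poly (map_poly f) G).
Proof. by rewrite /at_mark -horner2_map. Qed.

Lemma at_mark_eq (R : comNzRingType) (z z' : coord -> R) j G :
  z =1 z' -> at_mark z j G = at_mark z' j G.
Proof. by move=> zz; rewrite /at_mark !zz. Qed.

Lemma curve_of_eq (R : comNzRingType) (z z' : coord -> R) :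
  z =1 z' -> curve_of z = curve_of z'.
Proof.
move=> zz; rewrite /curve_of /weierstrass /low_part; congr (_ + _).
by do 2!apply: eq_bigr => ? _; rewrite zz.
Qed.

Section NewtonStep.

Variable K : fieldType.
Implicit Types (z : coord -> {poly K}) (d : coord -> K).

Lemma dvdXn_correct (u : {poly K}) (c : K) M :
  'X^M %| u -> u`_M + c = 0 -> 'X^(M.+1) %| u + 'X^M * c%:P.
Proof.
move=> /vanishes_toP u0 uM; apply/vanishes_toP => i; rewrite ltnS leq_eqVlt.
rewrite coefD coefMC coefXn => /predU1P[->|lt]; first by rewrite eqxx mul1r.
by rewrite u0 // (ltn_eqF lt) mul0r addr0.
Qed.

(** To first order in s^M, the three variations, of the two coordinates and of the
    polynomial, act independently and only through their values at s = 0. *)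
Lemma newton_expansion (M : nat) (G H : {poly {poly {poly K}}})
    (x y : {poly K}) (h k : K) :
  (0 < M)%N ->
  let e := 'X^M in
  'X^(M.+1) %| (G + e%:P%:P * H).[x + e * h%:P, y + e * k%:P]
             - (G.[x, y] + e * (h * (G^`().[x, y]).[0]
                               + k * ((derivY G).[x, y]).[0]
                               + (H.[x, y]).[0])%:P).
Proof.
move=> M_gt0; cbv zeta; set e := 'X^M; rewrite !(hornerD, hornerM, hornerC).
have [r ->] := taylor2 G x y e h%:P k%:P.
have [r' ->] := taylor2 H x y e h%:P k%:P.
set g1 := G^`().[x, y]; set g2 := (derivY G).[x, y]; set g3 := H.[x, y].
have split0 (g : {poly K}) : exists g', g = (g.[0])%:P + 'X * g'.
  have /factor_theorem[g' gE] : root (g - g.[0]%:P) 0.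
    by rewrite rootE !hornerE subrr.
  by exists g'; rewrite subr0 in gE; rewrite ['X * _]mulrC -gE addrC subrK.
have [g1' g1E] := split0 g1; have [g2' g2E] := split0 g2; have [g3' g3E] := split0 g3.
have [e' eE] : exists e', e = 'X * e' by exists 'X^(M.-1); rewrite -exprS prednK.
rewrite exprSr -/e; set c := (_ + _ + _)%:P; rewrite {}/c.
rewrite !rmorphD !rmorphM /=.
rewrite [in X in _ %| X - _]g1E [in X in _ %| X - _]g2E [in X in _ %| X - _]g3E.
apply/dvdpP.
exists (h%:P * g1' + k%:P * g2' + g3' + e' * (r + (h%:P * H^`().[x, y] +
          k%:P * (derivY H).[x, y]) + e * r')).
rewrite eE. ring.
Qed.

(** Choose the directions h, k, H so that the first-order effect cancels the
    coefficient of s^M in the error. *)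
Lemma newton_step (M : nat) (G H : {poly {poly {poly K}}})
    (x y : {poly K}) (h k : K) (tau : {poly K}) :
  (0 < M)%N -> 'X^M %| G.[x, y] - tau ->
  (G.[x, y] - tau)`_M + (h * (G^`().[x, y]).[0] + k * ((derivY G).[x, y]).[0]
                               + (H.[x, y]).[0]) = 0 ->
  'X^(M.+1) %| (G + ('X^M)%:P%:P * H).[x + 'X^M * h%:P, y + 'X^M * k%:P] - tau.
Proof.
move=> M_gt0 G_tau c0; rewrite -(subrK (G.[x, y] + 'X^M * (h * (G^`().[x, y]).[0]
  + k * ((derivY G).[x, y]).[0] + (H.[x, y]).[0])%:P) _.[_, _]) -addrA.
apply: dvdp_add; first exact: newton_expansion.
by rewrite addrAC; apply: dvdXn_correct.
Qed.

End NewtonStep.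

Section Arc.

Variables (K : fieldType) (z0 : coord -> K) (N : {set J}) (tau : J -> K).
Variable sigma : (J -> K) -> 'I_q -> 'I_p -> K.

Local Notation F0 := (curve_of z0).

(* The marked points of the initial curve are nondegenerate critical points with
   diagonal Hesse matrix, and are on the curve for j in N; by [sigmaP] the
   values at the latter of a perturbation of the curve are arbitrary. *)
Hypothesis crit_x0 : forall j, at_mark z0 j F0^`() = 0.
Hypothesis crit_y0 : forall j, at_mark z0 j (derivY F0) = 0.
Hypothesis Fxx0 : forall j, at_mark z0 j F0^`()^`() != 0.
Hypothesis Fyy0 : forall j, at_mark z0 j (derivY (derivY F0)) != 0.
Hypothesis Fxy0 : forall j, at_mark z0 j (derivY F0^`()) = 0.
Hypothesis node0 : forall j, j \in N -> at_mark z0 j F0 = 0.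
Hypothesis sigmaP : forall t j, j \in N ->
  at_mark z0 j (low_part (sigma t)) = t j.

(** Here 'X is the parameter s of the deformation: the critical value at the marked
    point j in N is to be tau_j s. *)
Record solves_upto (M : nat) (z : coord -> {poly K}) : Prop := SolvesUpto {
  solves_base : forall v, (z v).[0] = z0 v;
  solves_x : forall j, 'X^M %| at_mark z j (curve_of z)^`();
  solves_y : forall j, 'X^M %| at_mark z j (derivY (curve_of z));
  solves_val : forall j, j \in N ->
    'X^M %| at_mark z j (curve_of z) - (tau j)%:P * 'X }.

Lemma solves_upto1 : solves_upto 1 (polyC \o z0).
Proof.
have dvdX (g : {poly K}) : ('X^1 %| g) = (g.[0] == 0).
  by rewrite expr1 -['X]subr0 dvdp_XsubCl rootE.
have at0 j (G : {poly {poly K}}) :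
    at_mark (polyC \o z0) j (map_poly (map_poly polyC) G) = (at_mark z0 j G)%:P.
  by rewrite at_mark_map.
split=> [v|j|j|j jN]; first by rewrite hornerC.
- by rewrite -curve_of_map deriv_map at0 dvdX hornerC crit_x0.
- by rewrite -curve_of_map derivY_map at0 dvdX hornerC crit_y0.
by rewrite -curve_of_map at0 dvdX node0 // add0r hornerN hornerM hornerX mulr0 oppr0.
Qed.

(** The system of linearised equations is triangular.  At a critical point the
    critical value only varies with the equation of the curve, so the
    perturbation A of the coefficients is found first; then the displacement of
    each marked point, by dividing by the second derivatives. *)
Definition newton_dir (M : nat) (z : coord -> {poly K}) (v : coord) : K :=
  let F := curve_of z in
  let A := sigma (fun j => - (at_mark z j F - (tau j)%:P * 'X)`_M) in
  match v with
  | inl (nu, mu) => A nu mu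
  | inr (inl j) => - ((at_mark z j F^`())`_M + at_mark z0 j (low_part A)^`())
                   / at_mark z0 j F0^`()^`()
  | inr (inr j) =>
      - ((at_mark z j (derivY F))`_M + at_mark z0 j (derivY (low_part A)))
      / at_mark z0 j (derivY (derivY F0))
  end.

Definition newton_next (M : nat) (z : coord -> {poly K}) (v : coord) :
    {poly K} :=
  z v + 'X^M * (newton_dir M z v)%:P.

Lemma newton_next_solves M z :
  (0 < M)%N -> solves_upto M z -> solves_upto M.+1 (newton_next M z).
Proof.
move=> M_gt0 [z_base z_x z_y z_val]; set d := newton_dir M z.
pose ev0 : {rmorphism {poly K} -> K} := horner_eval (0 : K).
pose H := low_part (fun nu mu => (d (inl (nu, mu)))%:P).
have curveE : curve_of (newton_next M z) = curve_of z + ('X^M)%:P%:P * H.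
  exact: weierstrassD.
have at0 j G : (at_mark z j G).[0] = at_mark z0 j (map_poly (map_poly ev0) G).
  rewrite -[LHS]/(ev0 _) at_mark_map; apply: at_mark_eq => v /=; exact: z_base.
have F_0 : map_poly (map_poly ev0) (curve_of z) = F0.
  by rewrite curve_of_map; apply: curve_of_eq => v /=; apply: z_base.
have H_0 : map_poly (map_poly ev0) H =
    low_part (sigma (fun j => - (at_mark z j (curve_of z) - (tau j)%:P * 'X)`_M)).
  rewrite low_part_map /low_part; do 2!apply: eq_bigr => ? _.
  by rewrite /= /horner_eval hornerC.
split=> [v|j|j|j jN].
- rewrite hornerD hornerM hornerXn hornerC expr0n eqn0Ngt M_gt0 mul0r addr0.
  exact: z_base.
- rewrite curveE derivD derivM derivC mul0r add0r -[X in _ %| X]subr0.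
  apply: newton_step; rewrite ?subr0 //; first exact: z_x.
  rewrite -!/(at_mark z j _) !at0 -!derivY_map -!deriv_map F_0 H_0 Fxy0 mulr0 addr0.
  rewrite /d /newton_dir; field; exact: Fxx0.
- rewrite curveE derivYD derivYCM -[X in _ %| X]subr0.
  apply: newton_step; rewrite ?subr0 //; first exact: z_y.
  rewrite -!/(at_mark z j _) !at0 -!derivY_map -!deriv_map -!derivY_map F_0 H_0.
  rewrite -deriv_derivY Fxy0 mulr0 add0r.
  rewrite /d /newton_dir; field; exact: Fyy0.
- rewrite curveE; apply: newton_step => //; first exact: z_val.
  rewrite -!/(at_mark z j _) !at0 -!derivY_map -!deriv_map F_0 H_0.
  rewrite crit_x0 crit_y0 !mulr0 !add0r sigmaP //; exact: subrr.
Qed.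

Fixpoint newton_arc (M : nat) : coord -> {poly K} :=
  if M is M'.+1 then newton_next M (newton_arc M') else polyC \o z0.

Lemma newton_arc_solves M : solves_upto M.+1 (newton_arc M).
Proof. by elim: M => [|M IH]; [apply: solves_upto1 | apply: newton_next_solves]. Qed.

Lemma newton_arc_compat M v : 'X^M %| newton_arc M.+1 v - newton_arc M v.
Proof. by rewrite /= /newton_next addrAC subrr add0r exprSr -mulrA dvdp_mulIl. Qed.

End Arc.

End MarkedCurves.

(** * The number of critical points *)

Section CriticalPointBound.

Variables (K : fieldType) (p q : nat) (A : 'I_q -> 'I_p -> K).
Hypotheses (p_gt0 : (0 < p)%N) (q_gt0 : (0 < q)%N).
Hypotheses (p_neq0 : p%:R != 0 :> K) (q_neq0 : q%:R != 0 :> K).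

Local Notation F := (weierstrass A).
Local Notation B := ('I_q.-1 * 'I_p.-1)%type.

Definition critical (x y : K) : Prop :=
  F^`().[x, y] = 0 /\ (derivY F).[x, y] = 0.

Lemma weierstrass_derivX_horner x y :
  F^`().[x, y] = - (q%:R * x ^+ q.-1) +
    \sum_(nu < q) \sum_(mu < p | (nu * p + mu * q < p * q)%N)
      (nu%:R * A nu mu) * (x ^+ nu.-1 * y ^+ mu).
Proof.
rewrite derivD derivB -polyC_exp derivC sub0r derivXn hornerD hornerN hornerMn.
rewrite hornerXn -polyC_exp hornerD hornerN hornerMn hornerC mulr_natl; congr (_ + _).
rewrite /low_part raddf_sum !horner_sum; apply: eq_bigr => nu _.
rewrite raddf_sum !horner_sum; apply: eq_bigr => mu _ /=.
rewrite -polyC_exp -mulrA derivM derivC mul0r add0r derivM derivXn derivC mulr0 addr0.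
rewrite !(hornerM, hornerMn, hornerXn, hornerC) -polyC_exp.
rewrite !(hornerM, hornerMn, hornerXn, hornerC).
by rewrite -mulr_natl; ring.
Qed.

Lemma weierstrass_derivY_horner x y :
  (derivY F).[x, y] = p%:R * y ^+ p.-1 +
    \sum_(nu < q) \sum_(mu < p | (nu * p + mu * q < p * q)%N)
      (mu%:R * A nu mu) * (x ^+ nu * y ^+ mu.-1).
Proof.
have derivY_Xn n : derivY ('X ^+ n : {poly {poly K}}) = 0.
  by rewrite -['X ^+ n]mul1r derivYM_Xn derivY_const derivC mul0r.
rewrite derivYD derivYB derivY_Xn subr0 -polyC_exp derivY_const derivXn.
rewrite !hornerD !hornerC hornerMn hornerXn mulr_natl; congr (_ + _).
rewrite /low_part derivY_sum !horner_sum; apply: eq_bigr => nu _.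
rewrite derivY_sum !horner_sum; apply: eq_bigr => mu _ /=.
rewrite -mulrA ['X ^+ nu * _]mulrC mulrA -polyC_exp -polyCM derivYM_Xn derivY_const.
rewrite derivM derivC mul0r add0r derivXn hornerM hornerXn hornerC.
rewrite -polyC_exp !(hornerM, hornerMn, hornerXn, hornerC).
by rewrite -mulr_natl; ring.
Qed.

(** A normal form of f modulo the Jacobian ideal of F, in terms of the values on
    its zero set: the monomials in B are those not divisible by the leading
    monomials X^(q-1) of F_X and Y^(p-1) of F_Y. *)
Definition reduces (f : K -> K -> K) : Prop :=
  exists c : B -> K, forall x y, critical x y ->
    f x y = \sum_b c b * (x ^+ b.1 * y ^+ b.2).

Lemma reduces_eq f g :
  (forall x y, critical x y -> f x y = g x y) -> reduces g -> reduces f.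
Proof. by move=> fg [c gc]; exists c => x y xy; rewrite fg // gc. Qed.

Lemma reducesD f g :
  reduces f -> reduces g -> reduces (fun x y => f x y + g x y).
Proof.
move=> [c fc] [d gd]; exists (fun b => c b + d b) => x y xy.
by rewrite fc // gd // -big_split; apply: eq_bigr => b _; rewrite mulrDl.
Qed.

Lemma reducesZ a f : reduces f -> reduces (fun x y => a * f x y).
Proof.
move=> [c fc]; exists (fun b => a * c b) => x y xy.
by rewrite fc // mulr_sumr; apply: eq_bigr => b _; rewrite mulrA.
Qed.

Lemma reduces0 : reduces (fun _ _ => 0).
Proof. by exists (fun=> 0) => x y _; rewrite big1 // => b _; rewrite mul0r. Qed.

Lemma reduces_sum (I : Type) (r : seq I) (P : pred I) (f : I -> K -> K -> K) :
  (forall i, P i -> reduces (f i)) ->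
  reduces (fun x y => \sum_(i <- r | P i) f i x y).
Proof.
move=> fP; elim: r => [|i r IHr].
  by apply: reduces_eq reduces0 => x y _; rewrite big_nil.
case: (boolP (P i)) => Pi.
  by apply: reduces_eq (reducesD (fP i Pi) IHr) => x y _; rewrite big_cons Pi.
by apply: reduces_eq IHr => x y _; rewrite big_cons (negPf Pi).
Qed.

(** The equations F_X = 0 and F_Y = 0 express X^(q-1) and Y^(p-1) by monomials of
    smaller weight, where X has weight p and Y has weight q. *)
Lemma reduces_monomial i j : reduces (fun x y => x ^+ i * y ^+ j).
Proof.
have [n] := ubnP (i * p + j * q); elim: n i j => // n IHn i j lt_n.
have [le_qi|lt_iq] := leqP q.-1 i.
  apply: (@reduces_eq _ (fun x y => \sum_(nu < q)
      \sum_(mu < p | (nu * p + mu * q < p * q)%N)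
        (q%:R^-1 * nu%:R * A nu mu) * (x ^+ (i - q.-1 + nu.-1) * y ^+ (j + mu)))).
    move=> x y [Fx _]; rewrite -{1}(subnK le_qi) exprD.
    have -> : x ^+ q.-1 = q%:R^-1 * (q%:R * x ^+ q.-1) by rewrite mulKf.
    move: Fx; rewrite weierstrass_derivX_horner addrC => /subr0_eq <-.
    rewrite !(mulr_sumr, mulr_suml); apply: eq_bigr => nu _.
    rewrite !(mulr_sumr, mulr_suml); apply: eq_bigr => mu _.
    by rewrite !exprD; ring.
  apply: reduces_sum => nu _; apply: reduces_sum => mu w_mu.
  case: (posnP nu) => [->|nu_gt0].
    by apply: reduces_eq reduces0 => x y _; rewrite mulr0 !mul0r.
  apply/reducesZ/IHn; move: lt_n w_mu nu_gt0; clear -le_qi q_gt0 p_gt0.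
  move: (nat_of_ord nu) (nat_of_ord mu) => {nu} v {mu} m; nia.
have [le_pj|lt_jp] := leqP p.-1 j.
  apply: (@reduces_eq _ (fun x y => \sum_(nu < q)
      \sum_(mu < p | (nu * p + mu * q < p * q)%N)
        (- p%:R^-1 * mu%:R * A nu mu) * (x ^+ (i + nu) * y ^+ (j - p.-1 + mu.-1)))).
    move=> x y [_ Fy]; rewrite -{1}(subnK le_pj) exprD.
    have -> : y ^+ p.-1 = p%:R^-1 * (p%:R * y ^+ p.-1) by rewrite mulKf.
    move: Fy; rewrite weierstrass_derivY_horner => /eqP; rewrite addr_eq0 => /eqP ->.
    rewrite -sumrN !(mulr_sumr, mulr_suml); apply: eq_bigr => nu _.
    rewrite -sumrN !(mulr_sumr, mulr_suml); apply: eq_bigr => mu _.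
    by rewrite !exprD; ring.
  apply: reduces_sum => nu _; apply: reduces_sum => mu w_mu.
  case: (posnP mu) => [->|mu_gt0].
    by apply: reduces_eq reduces0 => x y _; rewrite mulr0 !mul0r.
  apply/reducesZ/IHn; move: lt_n w_mu mu_gt0; clear -le_pj q_gt0 p_gt0.
  move: (nat_of_ord nu) (nat_of_ord mu) => {nu} v {mu} m; nia.
exists (fun b => (b == (Ordinal lt_iq, Ordinal lt_jp))%:R) => x y _.
rewrite (bigD1 (Ordinal lt_iq, Ordinal lt_jp)) //= eqxx mul1r big1 ?addr0 //.
by move=> b /negPf->; rewrite mul0r.
Qed.

Lemma reduces_affineM a b c f :
  reduces f -> reduces (fun x y => (a * x + b * y + c) * f x y).
Proof.
move=> [d fd].
apply: (@reduces_eq _ (fun x y => \sum_e (a * d e * (x ^+ e.1.+1 * y ^+ e.2)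
   + (b * d e * (x ^+ e.1 * y ^+ e.2.+1) + c * d e * (x ^+ e.1 * y ^+ e.2))))).
  move=> x y xy; rewrite fd // mulr_sumr; apply: eq_bigr => e _.
  by rewrite !exprS; ring.
apply: reduces_sum => e _.
by apply: reducesD; [|apply: reducesD]; apply/reducesZ/reduces_monomial.
Qed.

(** The functions on a finite set of critical points are all polynomial, by
    Lagrange interpolation, and therefore spanned by the (q - 1)(p - 1) monomials
    to which polynomials reduce. *)
Lemma critical_points_card (J : finType) (pt : J -> K * K) :
  injective pt -> (forall j, critical (pt j).1 (pt j).2) ->
  (#|J| <= q.-1 * p.-1)%N.
Proof.
move=> pt_inj pt_crit.
(* An affine function equal to 1 at j and to 0 at k. *)
have sepP (j k : J) : exists t : K * K * K, j != k ->
    (t.1.1 * (pt k).1 + t.1.2 * (pt k).2 + t.2 = 0) /\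
    (t.1.1 * (pt j).1 + t.1.2 * (pt j).2 + t.2 = 1).
  have [->|jk] := eqVneq j k; first by exists (0, 0, 0).
  have [xx|xx] := eqVneq (pt j).1 (pt k).1; last first.
    have x0 : (pt j).1 - (pt k).1 != 0 by rewrite subr_eq0.
    exists ((((pt j).1 - (pt k).1)^-1, 0), - (pt k).1 / ((pt j).1 - (pt k).1)) => _ /=.
    by split; field.
  have y0 : (pt j).2 - (pt k).2 != 0.
    rewrite subr_eq0; apply: contra_neq jk => yy; apply: pt_inj.
    by rewrite [LHS]surjective_pairing [RHS]surjective_pairing xx yy.
  exists ((0, ((pt j).2 - (pt k).2)^-1), - (pt k).2 / ((pt j).2 - (pt k).2)) => _ /=.
  by split; field.
have lagrange (j : J) : exists c : B -> K, forall k : J,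
    \sum_b c b * ((pt k).1 ^+ b.1 * (pt k).2 ^+ b.2) = (k == j)%:R.
  have [f [[d fd] f0 f1]] : exists f, [/\ reduces f,
      forall k, k \in enum J -> k != j -> f (pt k).1 (pt k).2 = 0
      & f (pt j).1 (pt j).2 = 1].
    elim: (enum J) => [|k s [f [rf f0 f1]]].
      exists (fun _ _ => 1); split=> //.
      by apply: reduces_eq (reduces_monomial 0 0) => x y _; rewrite mul1r.
    have [kj|kj] := eqVneq k j.
      exists f; split=> // l; rewrite inE kj => /predU1P[->|]; first by rewrite eqxx.
      exact: f0.
    have [[[a b] c] /= /(_ _)[|t0 t1]] := sepP j k; first by rewrite eq_sym.
    exists (fun x y => (a * x + b * y + c) * f x y); split.
    - exact: reduces_affineM.
    - move=> l; rewrite inE => /predU1P[-> _|ls lj]; first by rewrite t0 mul0r.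
      by rewrite f0 ?mulr0.
    - by rewrite t1 f1 mulr1.
  exists d => k; rewrite -fd; last exact: pt_crit.
  by have [->|kj] := eqVneq k j; [rewrite f1 | rewrite f0 ?mem_enum].
have [c cP] := fin_all_exists lagrange.
pose V := \matrix_(a < #|J|, b < #|[set: B]|)
  ((pt (enum_val a)).1 ^+ (enum_val b).1 * (pt (enum_val a)).2 ^+ (enum_val b).2).
pose C := \matrix_(b < #|[set: B]|, a < #|J|) c (enum_val a) (enum_val b).
(* The identity matrix of size #|J| factors through (q - 1)(p - 1) dimensions. *)
have VC : V *m C = 1%:M.
  apply/matrixP => a a'; rewrite !mxE -(inj_eq enum_val_inj) -cP.
  rewrite [RHS](eq_bigl (fun b => b \in [set: B])) => [|b]; last by rewrite inE.
  rewrite [RHS]big_enum_val; apply: eq_bigr => b _; rewrite !mxE mulrC //.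
have := mxrankM_maxl V C; rewrite VC mxrank1 => /leq_trans; apply.
by apply: leq_trans (rank_leq_col _) _; rewrite cardsT card_prod !card_ord.
Qed.

Lemma critical_points_exhaust (J : finType) (pt : J -> K * K) (P : K * K) :
  injective pt -> (forall j, critical (pt j).1 (pt j).2) ->
  (q.-1 * p.-1 <= #|J|)%N -> critical P.1 P.2 -> exists j, P = pt j.
Proof.
move=> pt_inj pt_crit J_big P_crit.
suff /existsP[j /eqP ->] : [exists j, P == pt j] by exists j.
apply: contraT => P_new.
pose pt' (o : option J) := if o is Some j then pt j else P.
have nP j : P <> pt j by move=> Pj; case/existsP: P_new; exists j; apply/eqP.
have pt'_inj : injective pt'.
  move=> [j|] [k|] //= e; first by rewrite (pt_inj _ _ e).
    by case: (nP j); rewrite -e.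
  by case: (nP k).
have := critical_points_card pt'_inj; rewrite card_option ltnNge J_big => C.
by have /C : forall o, critical (pt' o).1 (pt' o).2 by case.
Qed.

End CriticalPointBound.

Section Specialization.

Variables (p q : nat) (J : finType) (K : closedFieldType).
Variables (z0 : coord p q J -> K) (N : {set J}) (tau : J -> K).
Variable sigma : (J -> K) -> 'I_q -> 'I_p -> K.

Local Notation F0 := (curve_of z0).
Local Notation mark z j := (z (inr (inl j)), z (inr (inr j))).

Hypothesis crit_x0 : forall j, at_mark z0 j F0^`() = 0.
Hypothesis crit_y0 : forall j, at_mark z0 j (derivY F0) = 0.
Hypothesis Fxx0 : forall j, at_mark z0 j F0^`()^`() != 0.
Hypothesis Fyy0 : forall j, at_mark z0 j (derivY (derivY F0)) != 0.
Hypothesis Fxy0 : forall j, at_mark z0 j (derivY F0^`()) = 0.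
Hypothesis node0 : forall j, (at_mark z0 j F0 == 0) = (j \in N).
Hypothesis sigmaP : forall t j, j \in N ->
  at_mark z0 j (low_part (sigma t)) = t j.
Hypothesis mark_inj0 : injective (fun j => mark z0 j).

(** The formal deformation is a point over K[[s]] of the variety of curves with
    marked points that satisfies the desired equations.  At this point none of
    the following vanishes: the Hesse determinants and the differences of marked
    points, because they do not for s = 0, and the values of F off the kept
    nodes, which are either nonzero for s = 0 or equal to tau_j s.  The kernel P
    of the evaluation there is prime, and the Nullstellensatz gives a K-point of
    P at which their product u does not vanish. *)
Lemma specialize_deformation :
  exists z : coord p q J -> K,
    [/\ injective (fun j => mark z j),
        forall j, at_mark z j (curve_of z)^`() = 0
          /\ at_mark z j (derivY (curve_of z)) = 0,
        forall j, at_mark z j (hessian (curve_of z)) != 0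
      & forall j, (at_mark z j (curve_of z) == 0) = (j \in N) && (tau j == 0)].
Proof.
pose R := polynomial_ring_fin K (coord p q J).
pose arc := newton_arc z0 tau sigma.
have arcP M : solves_upto z0 N tau M.+1 (arc M).
  by apply: newton_arc_solves => // j jN; apply/eqP; rewrite node0.
have arc_compat M v : 'X^M %| arc M.+1 v - arc M v.
  exact: newton_arc_compat.
pose rho M := s2val (pr_eval R (polyC : {rmorphism K -> {poly K}}) (arc M)).
have rhoC M : rho M \o @pr_const K _ R =1 polyC := s2valP (pr_eval R _ (arc M)).
have rhoX M : rho M \o @pr_var K _ R =1 arc M := s2valP' (pr_eval R _ (arc M)).
pose P h := forall M, 'X^M %| rho M h.
have primeP : prime_ideal P := arc_ideal_prime rhoC rhoX arc_compat.
pose X := @pr_var K _ R; pose F := curve_of X.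
have rhoF M : map_poly (map_poly (rho M)) F = curve_of (arc M).
  by rewrite curve_of_map; apply: curve_of_eq.
have rho_at M j G :
    rho M (at_mark X j G) = at_mark (arc M) j (map_poly (map_poly (rho M)) G).
  by rewrite at_mark_map; apply: at_mark_eq.
have lower M (h : {poly K}) : 'X^(M.+1) %| h -> 'X^M %| h.
  by apply: dvdp_trans; rewrite dvdp_exp2l.
pose ev0 : {rmorphism {poly K} -> K} := horner_eval (0 : K).
pose eps : {rmorphism pr_sort R -> K} := ev0 \o rho 1.
have epsX v : eps (X v) = z0 v.
  rewrite /= [rho 1 _]rhoX; exact: (solves_base (arcP 1)).
have epsF : map_poly (map_poly eps) F = F0.
  by rewrite curve_of_map; apply: curve_of_eq.
have eps_at j G :
    eps (at_mark X j G) = at_mark z0 j (map_poly (map_poly eps) G).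
  by rewrite at_mark_map; apply: at_mark_eq.
have nP_eps h : eps h != 0 -> ~ P h.
  by move=> eps_h /(_ 1); rewrite expr1 -['X]subr0 dvdp_XsubCl rootE; apply/negP.
have Px j : P (at_mark X j F^`()).
  move=> M; rewrite rho_at -deriv_map rhoF; apply: lower; exact: (solves_x (arcP M)).
have Py j : P (at_mark X j (derivY F)).
  move=> M; rewrite rho_at -derivY_map rhoF; apply: lower; exact: (solves_y (arcP M)).
have P0 j : j \in N -> tau j = 0 -> P (at_mark X j F).
  move=> jN tau0 M; rewrite rho_at rhoF; apply: lower.
  by have := solves_val (arcP M) jN; rewrite tau0 mul0r subr0.
(* The truncation modulo s^2 tells tau_j s from zero. *)
have nP0 j : ~~ ((j \in N) && (tau j == 0)) -> ~ P (at_mark X j F).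
  have [jN tau0|jN _] := boolP (j \in N); last first.
    by apply: nP_eps; rewrite eps_at epsF node0.
  move=> /(_ 2%N); rewrite rho_at rhoF => dvd_val.
  have := dvdp_sub dvd_val (lower _ _ (solves_val (arcP 2%N) jN)).
  rewrite subKr => /vanishes_toP/(_ 1 isT); rewrite coefMX coefC /= => tau_j.
  by rewrite tau_j eqxx in tau0.
have nPhess j : ~ P (at_mark X j (hessian F)).
  apply: nP_eps; rewrite eps_at -hessian_map epsF /at_mark /hessian.
  rewrite !(hornerD, hornerN, hornerM, expr2) -!/(at_mark z0 j _) Fxy0 mul0r subr0.
  by rewrite mulf_neq0.
(* A coordinate in which the initial marked points j and k differ. *)
pose gap j k : pr_sort R :=
  if z0 (inr (inl j)) == z0 (inr (inl k)) then X (inr (inr j)) - X (inr (inr k))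
  else X (inr (inl j)) - X (inr (inl k)).
have nPgap j k : j != k -> ~ P (gap j k).
  move=> jk; apply: nP_eps; rewrite /gap; case: ifP => [/eqP xx|xx].
    rewrite rmorphB !epsX subr_eq0; apply: contra_neq jk => yy.
    by apply: mark_inj0; rewrite xx yy.
  by rewrite rmorphB !epsX subr_eq0 xx.
pose u := (\prod_j at_mark X j (hessian F)) *
  (\prod_(j | ~~ ((j \in N) && (tau j == 0))) at_mark X j F) *
  (\prod_j \prod_(k | j != k) gap j k).
have nPu : ~ P u.
  rewrite /u => /(prime_idealM primeP)[/(prime_idealM primeP)[]|].
  - by apply: (prime_ideal_prod primeP) => j _; apply: nPhess.
  - exact: (prime_ideal_prod primeP).
  - apply: (prime_ideal_prod primeP) => j _.
    by apply: (prime_ideal_prod primeP) => k; apply: nPgap.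
have [psi [_ psiP]] := pr_points primeP nPu.
rewrite /u !rmorphM !mulf_eq0 !negb_or !rmorph_prod.
case/andP=> [/andP[/prodf_neq0 psi_hess /prodf_neq0 psi_val] /prodf_neq0 psi_gap].
have psiF : map_poly (map_poly psi) F = curve_of (psi \o X) by rewrite curve_of_map.
have psi_at j G :
    psi (at_mark X j G) = at_mark (psi \o X) j (map_poly (map_poly psi) G).
  by rewrite at_mark_map.
exists (psi \o X); rewrite -psiF; split=> [j k [xx yy]|j|j|j].
- apply/eqP; apply: contraT => jk; have := psi_gap j isT; rewrite rmorph_prod.
  move=> /prodf_neq0/(_ k jk); rewrite /gap.
  by case: ifP => _; rewrite rmorphB ?xx ?yy subrr eqxx.
- by rewrite deriv_map derivY_map -!psi_at; split; apply: psiP.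
- by rewrite hessian_map -psi_at; apply: psi_hess.
rewrite -psi_at; apply/idP/idP => [|/andP[jN /eqP tau0]].
  by apply: contraTT => /psi_val.
by apply/eqP/psiP/P0.
Qed.

End Specialization.

(** * Nodal curves with a prescribed number of nodes *)

Lemma weierstrass_normed (K : fieldType) (p q : nat) (A : 'I_q -> 'I_p -> K) :
  normed_weierstrass p q (weierstrass A).
Proof.
exists (fun i j => oapp (fun nu => oapp (A nu) 0 (insub j)) 0 (insub i)).
congr (_ + _); apply: eq_bigr => nu _; apply: eq_bigr => mu _.
by rewrite !valK.
Qed.

(** Start from D_p(Y) - D_q(X), mark its (p - 1)(q - 1) critical points, keep l of
    its nodes and give the others the critical value s. *)
Lemma marked_nodal_curve (K : closedFieldType) (charK0 : [pchar K] =i pred0)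
    (p q l : nat) :
  (1 < p)%N -> (1 < q)%N -> coprime p q -> (l <= (p.-1 * q.-1)./2)%N ->
  let J := ('I_q.-1 * 'I_p.-1)%type in
  exists (L : {set J}) (z : coord p q J -> K),
    [/\ #|L| = l,
        injective (fun j => (z (inr (inl j)), z (inr (inr j)))),
        forall j, at_mark z j (curve_of z)^`() = 0
          /\ at_mark z j (derivY (curve_of z)) = 0,
        forall j, at_mark z j (hessian (curve_of z)) != 0
      & forall j, (at_mark z j (curve_of z) == 0) = (j \in L)].
Proof.
move=> p_gt1 q_gt1 co_pq le_l J.
have p_gt0 := ltnW p_gt1; have q_gt0 := ltnW q_gt1.
have nat_neq0 n : (0 < n)%N -> n%:R != 0 :> K.
  move=> n_gt0; apply/negP => /(natf0_pchar n_gt0)[r].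
  by rewrite charK0 inE.
have N_gt0 : (0 < 2 * (p * q))%N by rewrite !muln_gt0 p_gt0.
have [omega omega_prim] := closed_prim_root N_gt0 (nat_neq0 _ N_gt0).
have primx := prim_root_x q_gt1 omega_prim.
have primy := prim_root_y p_gt1 omega_prim.
have size_lead n : (1 < n)%N -> (size (dickson K n - 'X^n)%R <= n)%N.
  by move=> n_gt1; have := dickson_lead K n; rewrite prednK // ltnW.
have [A0 A0E] :=
  weierstrass_separated p_gt0 q_gt0 (size_lead _ p_gt1) (size_lead _ q_gt1).
pose x j : K := crit_x omega (j : J); pose y j : K := crit_y omega (j : J).
pose z0 (v : coord p q J) := match v with
  | inl (nu, mu) => A0 nu mu | inr (inl j) => x j | inr (inr j) => y j end.
have F0E : curve_of z0 = (dickson K p)%:P - (dickson K q)^:P := A0E.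
have range_x (j : J) : (0 < j.1.+1 < q)%N by have := ltn_ord j.1; lia.
have range_y (j : J) : (0 < j.2.+1 < p)%N by have := ltn_ord j.2; lia.
have evC (f : {poly K}) a b : f%:P.[a, b] = f.[b] by rewrite hornerC.
have evX (f : {poly K}) a b : f^:P.[a, b] = f.[a].
  by rewrite horner_map hornerC.
have Fx : (curve_of z0)^`() = - (dickson K q)^`()^:P.
  by rewrite F0E derivB derivC sub0r deriv_map.
have Fy : derivY (curve_of z0) = (dickson K p)^`()%:P.
  by rewrite F0E derivYB derivY_polyC subr0 derivY_const.
pose N : {set J} := node_index p q.
have cardN : (2 * #|N| <= q.-1 * p.-1)%N := card_node_index p_gt1 q_gt1 co_pq.
have cardS := card_adjoint_exps p q.
have [|cardSN [s sP]] := interpolation_section _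
    (adjoint_vanish p_gt1 q_gt1 co_pq omega_prim).
  by rewrite -(leq_pmul2l (isT : 0 < 2)%N) (leq_trans cardN).
pose sigma t (nu : 'I_q) (mu : 'I_p) : K :=
  if (nu, mu) \in adjoint_exps p q then s t (nu, mu) else 0.
have [L LN cardL] : exists2 L : {set J}, L \subset N & #|L| = l.
  have : (l <= #|N|)%N.
    apply: leq_trans le_l (leq_trans _ cardSN).
    by rewrite mulnC -[leqRHS]doubleK -mul2n half_leq.
  rewrite cardE => le_lN; exists [set j in take l (enum N)].
    by apply/subsetP => j; rewrite inE => /mem_take; rewrite mem_enum.
  rewrite cardsE (card_uniqP _) ?size_takel // take_uniq // enum_uniq //.
have [||||||||z [z_inj z_crit z_hess z_val]] :=
  @specialize_deformation p q J K z0 N (fun j => (j \notin L)%:R) sigma.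
- by move=> j; rewrite /at_mark Fx !hornerN evX (dickson_crit primx) ?oppr0.
- by move=> j; rewrite /at_mark Fy evC (dickson_crit primy).
- move=> j; rewrite /at_mark Fx derivN !hornerN oppr_eq0 deriv_map evX.
  exact: (dickson_crit_nondeg primx).
- move=> j; rewrite /at_mark Fy derivY_const evC.
  exact: (dickson_crit_nondeg primy).
- move=> j; rewrite /at_mark Fx.
  by rewrite -[- _]sub0r derivYB derivY_polyC subr0 /derivY raddf0 !horner0.
- move=> j; rewrite /at_mark F0E !hornerD !hornerN evC evX /=.
  rewrite /x /y /crit_x /crit_y (dickson_crit_val primx) // (dickson_crit_val primy) //.
  rewrite -mulrBl mulf_eq0 (negPf (nat_neq0 2%N isT)) orbF subr_eq0.
  rewrite !exprS !mulN1r eqr_opp -signr_odd -[(-1) ^+ j.1]signr_odd inE eq_sym.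
  have m1 : (-1 == 1 :> K) = false.
    by rewrite -subr_eq0 -opprD oppr_eq0; apply: negPf (nat_neq0 2%N isT).
  by case: (odd j.1) (odd j.2) => -[]; rewrite ?expr0 ?expr1 ?eqxx ?m1 // eq_sym m1.
- move=> t j jN; rewrite /at_mark low_part_horner -[RHS](sP t j jN).
  rewrite pair_big_dep big_mkcond [RHS]big_mkcond; apply: eq_bigr => -[nu mu] _ /=.
  rewrite /sigma; have [mS|mS] := boolP (_ \in _); last by rewrite mul0r if_same.
  by rewrite ifT //; move: mS; rewrite inE /=; clear -p_gt0; lia.
- move=> j k /= [xx yy].
  have /= e1 := crit_pt_inj primx (range_x j) (range_x k) xx.
  have /= e2 := crit_pt_inj primy (range_y j) (range_y k) yy.
  case: j k e1 e2 {xx yy} => [i k] [i' k'] /= [e1] [e2].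
  by rewrite (val_inj e1) (val_inj e2).
exists L, z; split=> // j; rewrite z_val.
by case: (boolP (j \in L)) => [/(subsetP LN)->|]; rewrite ?eqxx // oner_eq0 andbF.
Qed.

Theorem theorem1p6 (K : closedFieldType) (charK0 : [pchar K] =i pred0)
    (p q : nat) (p_gt1 : (1 < p)%N) (p_lt_q : (p < q)%N) (co_pq : coprime p q)
    (l : nat) (l_ge1 : (1 <= l)%N) (l_le_d : (l <= (p.-1 * q.-1)./2)%N) :
  exists F : {poly {poly K}},
    [/\ normed_weierstrass p q F, nodal F & has_exactly_nodes F l].
Proof.
have q_gt1 := ltn_trans p_gt1 p_lt_q.
have p_gt0 := ltnW p_gt1; have q_gt0 := ltnW q_gt1.
have nat_neq0 n : (0 < n)%N -> n%:R != 0 :> K.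
  move=> n_gt0; apply/negP => /(natf0_pchar n_gt0)[r].
  by rewrite charK0 inE.
have [L [z [cardL z_inj z_crit z_hess z_val]]] :=
  marked_nodal_curve charK0 p_gt1 q_gt1 co_pq l_le_d.
pose Q j := (z (inr (inl j)), z (inr (inr j))).
(* A singular point is a critical point, hence a marked point because there is no
   room for others, hence a kept node because of its critical value. *)
have singP P : P \in singularity (curve_of z) -> exists2 j, j \in L & P = Q j.
  rewrite inE => /andP[FP /andP[/eqP FxP /eqP FyP]].
  have card_J : (q.-1 * p.-1 <= #|{: 'I_q.-1 * 'I_p.-1}|)%N.
    by rewrite card_prod !card_ord.
  have [j PE] := critical_points_exhaust p_gt0 q_gt0 (nat_neq0 p p_gt0)
    (nat_neq0 q q_gt0) z_inj z_crit card_J (conj FxP FyP).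
  by exists j => //; rewrite -z_val; move: FP; rewrite PE inE.
have nodeP j : j \in L -> Q j \in node (curve_of z).
  rewrite -z_val => Fj; rewrite !inE; have [Fx Fy] := z_crit j.
  apply/andP; split; last exact: z_hess.
  apply/andP; split; first exact: Fj.
  by apply/andP; split; apply/eqP.
exists (curve_of z); split.
- exact: weierstrass_normed.
- by move=> P /singP[j jL ->]; apply: nodeP.
exists [seq Q j | j <- enum L]; split.
- by rewrite map_inj_uniq ?enum_uniq.
- by rewrite size_map -cardE.
move=> P; apply/mapP/idP => [[j + ->]|]; first by rewrite mem_enum => /nodeP.
rewrite inE => /andP[/singP[j jL ->] _]; exists j => //.
by rewrite mem_enum.
Qed.
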